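(* Let $(\mathcal{X},T)$ be a dynamical system with a metric $d$ such that $(\mathcal{X},d)$ has the tame growth of covering numbers. Then $$\mathrm{mdim}_{\mathrm{H}}(\mathcal{X},T,d)\le\sup_{\mu\in\mathscr{M}^T(\mathcal{X})}\underline{\mathrm{rdim}}(\mathcal{X},T,d,\mu).$$
   Context: A dynamical system $(\mathcal{X},T)$ is a compact metrizable space $\mathcal{X}$ with a homeomorphism $T:\mathcal{X}\to\mathcal{X}$. Metrics on $\mathcal{X}$ are assumed compatible with the topology. $\mathscr{M}^T(\mathcal{X})$ is the set of $T$-invariant Borel probability measures on $\mathcal{X}$. Logarithms $\log$ are to base two. Quantities take values in $[0,\infty]$. Tame growth: for a compact metric space $(\mathcal{X},d)$, $\#(\mathcal{X},d,\varepsilon)$ is the minimum $n\ge1$ such that $\mathcal{X}$ has an open cover $\{U_1,\dots,U_n\}$ with $\mathrm{diam}\,U_i<\varepsilon$ for all $i$. $(\mathcal{X},d)$ has the tame growth of covering numbers if for every $\delta>0$, $\lim_{\varepsilon\to0}\varepsilon^\delta\log\#(\mathcal{X},d,\varepsilon)=0$. Mean Hausdorff dimension: for a compact metric space $(\mathcal{X},d)$, $s\ge0$, $\varepsilon>0$, $\mathcal{H}^s_\varepsilon(\mathcal{X},d)=\inf\{\sum_{n=1}^\infty(\mathrm{diam}\,E_n)^s : \mathcal{X}=\bigcup_{n=1}^\infty E_n,\ \mathrm{diam}\,E_n<\varepsilon\ \forall n\}$ with the conventions $0^0=1$ and $\mathrm{diam}(\emptyset)^s=0$; $\dim_{\mathrm{H}}(\mathcal{X},d,\varepsilon)=\sup\{s\ge0:\mathcal{H}^s_\varepsilon(\mathcal{X},d)\ge1\}$.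 With $d_N(x,y)=\max_{0\le n<N}d(T^nx,T^ny)$, $\mathrm{mdim}_{\mathrm{H}}(\mathcal{X},T,d)=\lim_{\varepsilon\to0}\big(\limsup_{N\to\infty}\frac1N\dim_{\mathrm{H}}(\mathcal{X},d_N,\varepsilon)\big)$. Mutual information: for finitely-valued $X,Y$, $I(X;Y)=H(X)+H(Y)-H(X,Y)$ ($H$ is Shannon entropy); in general $I(X;Y)$ is the supremum of $I(\mathcal{P}\circ X;\mathcal{Q}\circ Y)$ over finite measurable partitions $\mathcal{P},\mathcal{Q}$ of the target spaces (where $\mathcal{P}(x)$ is the element of $\mathcal{P}$ containing $x$). Rate distortion: for $\mu\in\mathscr{M}^T(\mathcal{X})$ and $\varepsilon>0$, $R(d,\mu,\varepsilon)$ is the infimum of $I(X;Y)/N$ over all positive integers $N$ and all random variables $X$, $Y=(Y_0,\dots,Y_{N-1})$ defined on some probability space, with $X$ and all $Y_n$ valued in $\mathcal{X}$, $\mathrm{Law}(X)=\mu$ and $\mathbb{E}\big(\frac1N\sum_{n=0}^{N-1}d(T^nX,Y_n)\big)<\varepsilon$. $\underline{\mathrm{rdim}}(\mathcal{X},T,d,\mu)=\liminf_{\varepsilon\to0}R(d,\mu,\varepsilon)/\log(1/\varepsilon)$. *)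

(* Defs.v *)
From HB Require Import structures.
From mathcomp Require Import all_boot all_order all_algebra.
From mathcomp Require Import all_classical all_reals all_analysis.

Set Implicit Arguments.
Unset Strict Implicit.
Unset Printing Implicit Defensive.

Import Order.TTheory GRing.Theory Num.Theory.
Import numFieldNormedType.Exports.

Local Open Scope classical_set_scope.
Local Open Scope ring_scope.

Definition log2 {R : realType} (x : R) : R := ln x / ln 2.

(* Suprema taken in [0, +oo]: the empty set has supremum 0, whereas
   [ereal_sup set0] is -oo. *)
Definition esup0 {R : realType} (A : set (\bar R)) : \bar R :=
  ereal_sup (0%E |` A).

Definition homeomorphism {X Y : topologicalType} (f : X -> Y) : Prop :=
  continuous f /\
  exists g : Y -> X, [/\ continuous g, cancel f g & cancel g f].

(* The metric-dependent notions take an arbitrary distance function, because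
   they are applied to the metrics [dyn_dist T d N] besides [mdist]. *)

Definition diam {R : realType} {X : Type} (d : X -> X -> R) (E : set X) :
    \bar R :=
  esup0 [set (d x y)%:E | x in E & y in E].

Definition has_open_cover {R : realType} {X : topologicalType}
    (d : X -> X -> R) (eps : R) (n : nat) : Prop :=
  exists U : 'I_n -> set X,
    [/\ forall i, open (U i),
        \bigcup_i U i = [set: X] &
        forall i, (diam d (U i) < eps%:E)%E].

(* The junk value 0 of [get] occurs only when there is no finite cover, hence
   never on a compact space with a compatible metric and eps > 0. *)
Definition covering_number {R : realType} {X : topologicalType}
    (d : X -> X -> R) (eps : R) : nat :=
  [get n : nat | [/\ (1 <= n)%N, has_open_cover d eps n &
     forall m : nat, (1 <= m)%N -> has_open_cover d eps m -> (n <= m)%N]].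

Definition tame_growth {R : realType} {X : topologicalType}
    (d : X -> X -> R) : Prop :=
  forall delta : R, 0 < delta ->
    eps `^ delta * log2 (covering_number d eps)%:R @[eps --> 0^'+] --> (0 : R).

(* [poweR] already satisfies 0 `^ 0 = 1. *)
Definition diam_pow {R : realType} {X : Type} (d : X -> X -> R) (E : set X)
    (s : R) : \bar R :=
  if E == set0 then 0%E else poweR (diam d E) s.

Definition hausdorff_sum {R : realType} {X : Type} (d : X -> X -> R)
    (s eps : R) : \bar R :=
  ereal_inf [set (\sum_(0 <= n <oo) diam_pow d (E n) s)%E |
    E in [set E : nat -> set X | \bigcup_n E n = [set: X] /\
                                 forall n, (diam d (E n) < eps%:E)%E]].

Definition hausdorff_dim {R : realType} {X : Type} (d : X -> X -> R)
    (eps : R) : \bar R :=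
  esup0 [set s%:E | s in [set s : R | 0 <= s /\
                                      (1 <= hausdorff_sum d s eps)%E]].

Definition dyn_dist {R : realType} {X : Type} (T : X -> X) (d : X -> X -> R)
    (N : nat) (x y : X) : R :=
  \big[Num.max/0]_(n < N) d (iter n T x) (iter n T y).

(* The outer limit exists in the extended reals: the limsup is monotone
   in eps. *)
Definition mdimH {R : realType} {X : Type} (T : X -> X) (d : X -> X -> R) :
    \bar R :=
  lim (limn_esup (fun N : nat =>
         ((N%:R^-1)%:E * hausdorff_dim (dyn_dist T d N) eps)%E)
       @[eps --> (0 : R)^'+]).

(* X with its Borel sigma-algebra. Measurable types of the library are pointed;
   x0 only provides this point and the sigma-algebra does not depend on it. *)
Definition borel {X : topologicalType} (x0 : X) : Type := X.

HB.instance Definition _ (X : topologicalType) (x0 : X) :=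
  Choice.copy (borel x0) X.
HB.instance Definition _ (X : topologicalType) (x0 : X) :=
  isPointed.Build (borel x0) x0.
HB.instance Definition _ (X : topologicalType) (x0 : X) :=
  @isMeasurable.Build (sigma_display (@open X)) (borel x0) <<s @open X >>
    (@sigma_algebra0 _ _ _) (@sigma_algebraC _ _) (@sigma_algebra_bigcup _ _ _).

Definition invariant_measure {R : realType} {X : topologicalType} {x0 : X}
    (T : X -> X) (mu : probability (borel x0) R) : Prop :=
  forall A : set (borel x0), measurable A -> mu (T @^-1` A) = mu A.

(* 0 * log2 0 = 0 since [ln 0 = 0]. *)
Definition entropy {R : realType} {disp : measure_display}
    {Omega : measurableType disp} (P : probability Omega R) {A : finType}
    (Z : Omega -> A) : R :=
  - \sum_(a : A) (let p := fine (P (Z @^-1` [set a])) in p * log2 p).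

Definition fin_mutual_info {R : realType} {disp : measure_display}
    {Omega : measurableType disp} (P : probability Omega R) {A B : finType}
    (Z : Omega -> A) (W : Omega -> B) : R :=
  entropy P Z + entropy P W - entropy P (fun w => (Z w, W w)).

Definition measurable_partition {disp : measure_display}
    {S : measurableType disp} {k : nat} (F : 'I_k.+1 -> set S) : Prop :=
  partition [set: 'I_k.+1] F [set: S] /\ forall i, measurable (F i).

(* An element of the partition is represented by its index; ord0 is not
   reached, as F covers S. *)
Definition cell {S : Type} {k : nat} (F : 'I_k.+1 -> set S) (x : S) : 'I_k.+1 :=
  xget ord0 [set i | F i x].

Definition mutual_info {R : realType} {disp disp1 disp2 : measure_display}
    {Omega : measurableType disp} {S1 : measurableType disp1}
    {S2 : measurableType disp2} (P : probability Omega R)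
    (X : {RV P >-> S1}) (Y : {RV P >-> S2}) : \bar R :=
  ereal_sup [set v : \bar R |
    exists (k l : nat) (F : 'I_k.+1 -> set S1) (G : 'I_l.+1 -> set S2),
      [/\ measurable_partition F, measurable_partition G &
          v = (fin_mutual_info P (cell F \o X) (cell G \o Y))%:E]].

(* The law of X is compared with mu on measurable sets only: the values of
   measures on other sets are unspecified. *)
Definition rate_distortion {R : realType} {X : topologicalType} {x0 : X}
    (T : X -> X) (d : X -> X -> R) (mu : probability (borel x0) R) (eps : R) :
    \bar R :=
  ereal_inf [set v : \bar R |
    exists (N : nat) (disp : measure_display) (Omega : measurableType disp)
           (P : probability Omega R)
           (Z : {RV P >-> borel x0}) (Y : {RV P >-> N.-tuple (borel x0)}),
      [/\ (0 < N)%N,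
          forall A : set (borel x0), measurable A -> P (Z @^-1` A) = mu A,
          ('E_P[fun w => (N%:R^-1 *
                  \sum_(n < N) d (iter n T (Z w)) (tnth (Y w) n))%R]
             < eps%:E)%E &
          v = ((N%:R^-1)%:E * mutual_info Z Y)%E]].

Definition lower_rdim {R : realType} {X : topologicalType} {x0 : X}
    (T : X -> X) (d : X -> X -> R) (mu : probability (borel x0) R) : \bar R :=
  limf_einf (fun eps : R =>
    (rate_distortion T d mu eps * ((log2 eps^-1)^-1)%:E)%E) (0 : R)^'+.

(* Main.v *)
Require Import Defs.
From HB Require Import structures.
From mathcomp Require Import all_boot all_order all_algebra.
From mathcomp Require Import all_classical all_reals all_analysis.
From mathcomp Require Import measurable_realfun.
From mathcomp Require Import ring lra zify.

(** Idea of the proof. Let s be smaller than the mean Hausdorff dimension. For one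
    small delta and infinitely many N, every finite cover of X by sets of
    d_N-diameter at most a_j < delta satisfies sum_j a_j^(s N) >= 1
    ([frequently_large_dim], [cover_of_hausdorff_dim]). Such a covering bound
    yields a finitely supported probability nu_N giving mass at most (8 rho)^(s N)
    to the d_N-balls of radius rho, for all dyadic rho between 2^-k0 and
    2^-(k0 + N), where 8 2^-k0 < delta ([finite_frostman], [frostman_dyn_dist]).
    The factor 8^(s N) is harmless: after taking logarithms and dividing by N it becomes a constant, which
    disappears in comparison with log (1 / eps). This tolerance of factors C^N is
    what allows a greedy construction followed by a Vitali selection in place of
    a duality argument.

    Tame growth passes from d_N to the mean distance along the orbit. A point
    whose orbit is at mean distance at most a^(1 + theta) from a word y has at most
    N a^theta coordinates farther than a from y. Choosing these coordinates and
    covering X by C(a) sets of diameter less than a for each of them cuts the mean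
    ball into at most 2^N C(a)^(N a^theta) <= 4^N sets of d_N-diameter 2 a
    ([mean_ball_mass]). So nu_N gives mean balls of radius a^(1 + theta) mass at
    most 2^(- N Lam(a)), where Lam(a) = s log (1 / a) - 2 - 5 s
    ([frostman_mean_ball]).

    The invariant measure mu comes from the orbit averages of the nu_N. Their limit
    along an ultrafilter is a finitely additive, T-invariant function p of all
    subsets of X ([ultra_mean_limit]). The outer measure generated by the values of
    p on open sets is additive on open pieces by an exhaustion argument, so it
    restricts to a Borel probability mu ([borel_extension]), and mu = p on the
    Borel sets with mu-null frontier ([null_frontier_eq]).

    Let now Z, Y be a coupling for mu with blocks of length m and mean distortion
    less than eps. Quantize it by a fine partition of X whose pieces have null
    frontier: this gives a kernel W between finite alphabets
    ([discretize_coupling]). For each offset k < m, code a nu_N-random orbit by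
    applying W independently to the blocks of length m that start at the times
    k + j m. Gibbs' inequality, tested against a density concentrated on a mean
    ball, bounds the relative entropy of this code from below by
    N Lam(a) (1 - distortion / a^(1 + theta)), up to a bounded error
    ([product_coding_bound], [block_coding_offset]). Averaged
    over the offsets, the entropies and the distortions become sums over the orbit
    average of nu_N ([block_coding]); these converge to the mutual information and
    to the distortion of the quantized coupling. Hence the rate distortion function
    of mu at eps is at least Lam(a) (1 - eps / a^(1 + theta))
    ([rate_distortion_lower_bound]). Taking a^(1 + theta) = L eps with L large and
    theta small shows that the lower rate distortion dimension of mu is as close to
    s as desired ([lower_rdim_ge]). *)

Set Implicit Arguments.
Unset Strict Implicit.
Unset Printing Implicit Defensive.

Import Order.TTheory GRing.Theory Num.Theory.
Import numFieldNormedType.Exports.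

Local Open Scope classical_set_scope.
Local Open Scope ring_scope.

(** * Logarithms and Gibbs inequality on finite alphabets *)

Section log2_theory.
Context {R : realType}.
Implicit Types x y : R.

Lemma ln2_gt0 : 0 < ln 2 :> R.
Proof. by rewrite ln_gt0 // ltr1n. Qed.

Lemma log2M x y : 0 < x -> 0 < y -> log2 (x * y) = log2 x + log2 y.
Proof. by move=> x0 y0; rewrite /log2 lnM ?posrE // mulrDl. Qed.

Lemma log2V x : 0 < x -> log2 x^-1 = - log2 x.
Proof. by move=> x0; rewrite /log2 lnV ?posrE // mulNr. Qed.

Lemma log2_1 : log2 1 = 0 :> R.
Proof. by rewrite /log2 ln1 mul0r. Qed.

Lemma log2_2 : log2 2 = 1 :> R.
Proof. by rewrite /log2 divff // gt_eqF // ln2_gt0. Qed.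

Lemma ler_log2 x y : 0 < x -> x <= y -> log2 x <= log2 y.
Proof.
move=> x0 xy; rewrite /log2 ler_pM2r ?invr_gt0 ?ln2_gt0 //.
by rewrite ler_ln ?posrE // (lt_le_trans x0).
Qed.

Lemma log2_le_sub1 x : 0 < x -> log2 x <= (x - 1) / ln 2.
Proof.
move=> x0; rewrite /log2 ler_pM2r ?invr_gt0 ?ln2_gt0 //.
have := @le_ln1Dx R (x - 1); rewrite (addrC 1) subrK; apply; lra.
Qed.

Lemma log2_powR x y : 0 < x -> log2 (x `^ y) = y * log2 x.
Proof. by move=> x0; rewrite /log2 ln_powR mulrA. Qed.

Lemma log2_prod (I : finType) (F : I -> R) : (forall i, 0 < F i) ->
  log2 (\prod_i F i) = \sum_i log2 (F i).
Proof.
move=> F0.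
suff [] : 0 < \prod_i F i /\ log2 (\prod_i F i) = \sum_i log2 (F i) by [].
elim/big_rec2 : _ => [|i y x _ [x0 ihx]]; first by rewrite log2_1.
by rewrite mulr_gt0 // log2M // ihx.
Qed.

End log2_theory.

Section finite_information.
Context {R : realType}.

(** Each term dominates (w i - u i) / ln 2, as ln t <= t - 1. *)
Lemma gibbs (I : finType) (w u : I -> R) :
  (forall i, 0 <= w i) -> (forall i, 0 <= u i) ->
  (forall i, 0 < w i -> 0 < u i) -> \sum_i u i <= \sum_i w i ->
  0 <= \sum_i w i * log2 (w i / u i).
Proof.
move=> w0 u0 wu sumuw.
apply: (@le_trans _ _ (\sum_i (w i - u i) / ln 2)).
  by rewrite -mulr_suml mulr_ge0 ?invr_ge0 ?(ltW ln2_gt0) // sumrB subr_ge0.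
apply: ler_sum => i _; have [wi0|wi0] := eqVneq (w i) 0.
  rewrite wi0 mul0r sub0r mulNr oppr_le0 mulr_ge0 ?invr_ge0 ?u0 //.
  exact/ltW/ln2_gt0.
have {}wi0 : 0 < w i by rewrite lt_neqAle eq_sym wi0 w0.
have ui0 := wu _ wi0.
have h : w i * log2 (u i / w i) <= (u i - w i) / ln 2.
  have := @log2_le_sub1 R (u i / w i); rewrite divr_gt0 // => /(_ isT).
  rewrite -(ler_pM2l wi0) => /le_trans; apply.
  rewrite mulrA mulrBr mulr1 mulrCA divff ?gt_eqF // mulr1.
  by rewrite lexx.
rewrite -[w i / u i]invf_div log2V ?divr_gt0 // mulrN lerNr.
by rewrite -mulNr opprB.
Qed.

Lemma sum_prod_kernel (B J : finType) (W : J -> B -> R) :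
  (forall j, \sum_b W j b = 1) ->
  \sum_(f : {ffun J -> B}) \prod_j W j (f j) = 1.
Proof.
by move=> W1; rewrite -bigA_distr_bigA /= big1 // => j _; rewrite W1.
Qed.

Lemma sum_prod_coord (B J : finType) (W : J -> B -> R) (phi : B -> R) (j0 : J) :
  (forall j, \sum_b W j b = 1) ->
  \sum_(f : {ffun J -> B}) (\prod_j W j (f j)) * phi (f j0) =
  \sum_b W j0 b * phi b.
Proof.
move=> W1; pose W' j b := W j b * (if j == j0 then phi b else 1).
transitivity (\sum_(f : {ffun J -> B}) \prod_j W' j (f j)).
  apply: eq_bigr => f _; rewrite /W' big_split /=; congr (_ * _).
  by rewrite (bigD1 j0) //= eqxx big1 ?mulr1 // => j /negbTE ->.
rewrite -bigA_distr_bigA (bigD1 j0) //= [X in _ * X]big1 ?mulr1.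
  by apply: eq_bigr => b _; rewrite /W' eqxx.
by move=> j /negbTE jj0; rewrite -(W1 j); apply: eq_bigr => b _;
  rewrite /W' jj0 mulr1.
Qed.

Lemma sum_prod_sum (B J : finType) (W phi : J -> B -> R) :
  (forall j, \sum_b W j b = 1) ->
  \sum_(f : {ffun J -> B}) (\prod_j W j (f j)) * \sum_j phi j (f j) =
  \sum_j \sum_b W j b * phi j b.
Proof.
move=> W1; under eq_bigr => f _ do rewrite mulr_sumr.
by rewrite exchange_big; apply: eq_bigr => j _; exact: sum_prod_coord.
Qed.

(** This replaces a lower bound on the mutual information between a nu-random
    point and its code: the law of the code is compared with the product of q, and
    Gibbs' inequality is applied to nu (x) W against nu (x) q weighted by a
    density that charges the ball D <= r. Bounding the logarithm of this density by
    an affine function of D makes the estimate linear in the distortion, so that it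
    can later be averaged over the offsets of the blocks without any convexity
    argument. The bound of D by c plus a sum over coordinates reduces its mean to
    single-letter sums. *)
Lemma product_coding_bound (I B J : finType) (nu : I -> R) (W : I -> J -> B -> R)
    (q : B -> R) (D : I -> {ffun J -> B} -> R) (p r c : R)
    (e : I -> J -> B -> R) :
  (forall a, 0 <= nu a) -> \sum_a nu a = 1 ->
  (forall a j b, 0 <= W a j b) -> (forall a j, \sum_b W a j b = 1) ->
  (forall b, 0 <= q b) -> \sum_b q b = 1 ->
  (forall a j b, 0 < W a j b -> 0 < q b) ->
  (forall a f, 0 <= D a f) ->
  (forall a f, D a f <= c + \sum_j e a j (f j)) ->
  0 < p <= 1 -> 0 < r ->
  (forall f, \sum_(a | D a f <= r) nu a <= p) ->
  -1 + log2 p^-1 * (1 - r^-1 * (c +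
     \sum_a nu a * \sum_j \sum_b W a j b * e a j b)) <=
  \sum_a nu a * \sum_j \sum_b W a j b * log2 (W a j b / q b).
Proof.
move=> nu0 nu1 W0 W1 q0 q1 Wq D0 De /andP[p0 p1] r0 Dp.
have L0 : 0 <= log2 p^-1 by rewrite -(@log2_1 R) ler_log2 // invf_ge1.
pose WW a (f : {ffun J -> B}) := \prod_j W a j (f j).
pose Q (f : {ffun J -> B}) := \prod_j q (f j).
(* a density with respect to nu: its integral is at most 1/2 + p / (2 p) = 1 *)
pose g a f : R := 2^-1 + (if D a f <= r then (2 * p)^-1 else 0).
have g0 a f : 0 < g a f.
  rewrite /g; case: ifP => _; rewrite ?addr0 ?invr_gt0 ?ltr0n //.
  by rewrite addr_gt0 ?invr_gt0 ?mulr_gt0 ?ltr0n.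
pose w (x : I * {ffun J -> B}) := nu x.1 * WW x.1 x.2.
pose u (x : I * {ffun J -> B}) := nu x.1 * g x.1 x.2 * Q x.2.
have WW0 a f : 0 <= WW a f by apply: prodr_ge0.
have WW1 a : \sum_f WW a f = 1 by apply: sum_prod_kernel.
have Q0 f : 0 <= Q f by apply: prodr_ge0.
have Q1 : \sum_f Q f = 1 by apply: (@sum_prod_kernel _ _ (fun=> q)).
have W_gt0 a f : 0 < WW a f -> forall j, 0 < W a j (f j).
  move=> wwf j; rewrite lt_neqAle W0 andbT eq_sym; apply/eqP => Wj.
  by move: wwf; rewrite /WW (bigD1 j) //= Wj mul0r ltxx.
have sumw : \sum_x w x = 1.
  rewrite -(pair_bigA _ (fun a f => nu a * WW a f)) /= -nu1.
  by apply: eq_bigr => a _; rewrite -mulr_sumr WW1 mulr1.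
have sumu : \sum_x u x <= 1.
  rewrite -(pair_bigA _ (fun a f => nu a * g a f * Q f)) /= exchange_big /= -Q1.
  apply: ler_sum => f _; rewrite -mulr_suml ler_piMl //.
  rewrite /g; under eq_bigr do rewrite mulrDr.
  rewrite big_split /= -mulr_suml nu1 mul1r.
  have -> : \sum_a nu a * (if D a f <= r then (2 * p)^-1 else 0) =
     (\sum_(a | D a f <= r) nu a) * (2 * p)^-1.
    rewrite mulr_suml [RHS]big_mkcond; apply: eq_bigr => a _.
    by case: ifP; rewrite ?mulr0.
  rewrite (@le_trans _ _ (2^-1 + p * (2 * p)^-1)) ?lerD2l //.
    by rewrite ler_pM2r ?invr_gt0 ?mulr_gt0.
  by rewrite invfM mulrCA divff ?gt_eqF // mulr1; lra.
have key : 0 <= \sum_x w x * log2 (w x / u x).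
  apply: gibbs; rewrite ?sumw //.
  - by move=> x; rewrite mulr_ge0.
  - by move=> x; rewrite !mulr_ge0 // ltW.
  - move=> [a f]; rewrite /w /u /= => /[dup] wx.
    rewrite lt_neqAle eq_sym mulf_eq0 negb_or -andbA.
    case/and3P => na nw _; rewrite !mulr_gt0 ?g0 //.
      by rewrite lt_neqAle eq_sym na nu0.
    apply: prodr_gt0 => j _; apply: (Wq a j); apply: W_gt0.
    by rewrite lt_neqAle eq_sym nw WW0.
have term (x : I * {ffun J -> B}) : w x * log2 (w x / u x) <=
   w x * (\sum_j log2 (W x.1 j (x.2 j) / q (x.2 j))) -
   w x * (-1 + log2 p^-1 * (1 - r^-1 * (c + \sum_j e x.1 j (x.2 j)))).
  rewrite -mulrBr; have [->|wx] := eqVneq (w x) 0; first by rewrite !mul0r.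
  have {}wx : 0 < w x by rewrite lt_neqAle eq_sym wx mulr_ge0.
  rewrite ler_pM2l //; case: x wx => a f; rewrite /w /u /= => wx.
  have na : 0 < nu a.
    by rewrite lt_neqAle nu0 andbT; apply: contraTneq wx => <-; rewrite mul0r ltxx.
  have wwa : 0 < WW a f by move: wx; rewrite pmulr_rgt0.
  have Wa := W_gt0 _ _ wwa.
  have qf j : 0 < q (f j) by apply: (Wq a j).
  have Qf : 0 < Q f by apply: prodr_gt0.
  have -> : nu a * WW a f / (nu a * g a f * Q f) = (WW a f / Q f) * (g a f)^-1.
    by field; rewrite !gt_eqF ?Qf ?na ?g0.
  rewrite log2M ?divr_gt0 ?invr_gt0 // log2V // lerB //.
    rewrite /WW /Q -prodf_div log2_prod // => j; exact: divr_gt0.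
  have [Dr|Dr] := leP (D a f) r.
    apply: (@le_trans _ _ (log2 (2 * p)^-1)); last first.
      by rewrite ler_log2 ?invr_gt0 ?mulr_gt0 // /g Dr lerDr invr_ge0 ler0n.
    rewrite invfM log2M ?invr_gt0 // (@log2V R 2) // log2_2 lerD2l.
    apply: ler_piMr => //; rewrite gerBl mulr_ge0 ?invr_ge0 ?(ltW r0) //.
    exact: le_trans (D0 a f) (De a f).
  rewrite /g ifF ?addr0; last by rewrite leNgt Dr.
  rewrite (@log2V R 2) // log2_2 -[leRHS]addr0 lerD2l.
  rewrite mulr_ge0_le0 // subr_le0 mulrC ler_pdivlMr // mul1r.
  exact: le_trans (ltW Dr) (De a f).
have := le_trans key (ler_sum _ (fun x _ => term x)).
rewrite sumrB subr_ge0.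
rewrite -(pair_bigA _ (fun a f => nu a * WW a f * \sum_j log2 (W a j (f j) / q (f j)))) /=.
have -> : \sum_a \sum_f nu a * WW a f * \sum_j log2 (W a j (f j) / q (f j)) =
   \sum_a nu a * \sum_j \sum_b W a j b * log2 (W a j b / q b).
  apply: eq_bigr => a _; under eq_bigr do rewrite -mulrA.
  rewrite -mulr_sumr; congr (_ * _).
  exact: (sum_prod_sum (fun j b => log2 (W a j b / q b)) (W1 a)).
apply: le_trans.
set L := log2 p^-1.
have -> : \sum_a nu a * (\sum_j \sum_b W a j b * e a j b) =
    \sum_x w x * \sum_j e x.1 j (x.2 j).
  rewrite -(pair_bigA _ (fun a f => nu a * WW a f * \sum_j e a j (f j))) /=.
  apply: eq_bigr => a _; under [RHS]eq_bigr do rewrite -mulrA.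
  by rewrite -mulr_sumr (sum_prod_sum (e a) (W1 a)).
under [leRHS]eq_bigr => x _.
  have -> : forall s, w x * (-1 + L * (1 - r^-1 * (c + s))) =
     (-1 + L - L * r^-1 * c) * w x + (- L * r^-1) * (w x * s) by move=> s; ring.
  over.
rewrite big_split /= -!mulr_sumr sumw; rewrite le_eqVlt; apply/orP; left; apply/eqP; ring.
Qed.

End finite_information.

(** * A finite Frostman lemma *)

Section finite_frostman.
Context {R : realType}.

(** A maximal packing saturates some constraint through each point, since
    otherwise the mass of that point could be increased. Processing the points one
    after the other produces such a packing: a saturated constraint stays saturated
    because masses only grow and never exceed the bound. *)
Lemma greedy_packing (I P : finType) (S : I -> pred P) (w : I -> R) :
  (forall i, 0 <= w i) -> (forall b, exists i, S i b) ->
  exists nu : P -> R, [/\ forall b, 0 <= nu b,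
    forall i, \sum_(b | S i b) nu b <= w i &
    forall b, exists2 i, S i b & \sum_(b' | S i b') nu b' = w i].
Proof.
move=> w0 cov.
suff [nu [nu0 nuw tight]] : exists nu : P -> R, [/\ forall b, 0 <= nu b,
    forall i, \sum_(b | S i b) nu b <= w i &
    forall b, b \in enum P -> exists2 i, S i b & \sum_(b' | S i b') nu b' = w i].
  by exists nu; split => // b; apply: tight; rewrite mem_enum.
elim: (enum P) => [|b0 s [nu [nu0 nuw tight]]].
  by exists (fun=> 0); split => // i; rewrite big1.
have [i1 Si1] := cov b0.
(* i0 is the constraint through b0 with the least slack *)
have [i0 Si0 mini0] := @Order.TotalTheory.arg_minP _ _ _ i1 (fun i => S i b0)
  (fun i => w i - \sum_(b | S i b) nu b) Si1.
move: mini0; set t := w i0 - _ => mini0.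
have t0 : 0 <= t by rewrite subr_ge0.
pose nu' b := nu b + (if b == b0 then t else 0).
have nu'S i : \sum_(b | S i b) nu' b =
    \sum_(b | S i b) nu b + (if S i b0 then t else 0).
  rewrite big_split /=; congr (_ + _); case: ifPn => Sib.
    rewrite (bigD1 b0) //= eqxx big1 ?addr0 // => b /andP[_ /negbTE ->] //.
  rewrite big1 // => b Sb; case: eqP => // bb0.
  by move: Sib; rewrite -bb0 Sb.
exists nu'; split.
- by move=> b; rewrite /nu' addr_ge0 //; case: ifP.
- move=> i; rewrite nu'S; case: ifPn => Sib; last by rewrite addr0.
  by rewrite -lerBrDl; exact: mini0.
- move=> b; rewrite inE => /predU1P[->|/tight [i Sib eqi]].
    by exists i0 => //; rewrite nu'S Si0 /t addrC subrK.
  exists i => //; rewrite nu'S eqi; case: ifPn => Si; last by rewrite addr0.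
  suff -> : t = 0 by rewrite addr0.
  by apply/eqP; rewrite eq_le t0 andbT (le_trans (mini0 _ Si)) // eqi subrr.
Qed.

(** Select an index of maximal rank, discard everything that meets it, and
    repeat. *)
Lemma vitali_selection (I : finType) (meet : rel I) (rho : I -> R) (A : {set I}) :
  reflexive meet -> symmetric meet ->
  exists D : {set I}, [/\ D \subset A,
    {in D &, forall i j, i != j -> ~~ meet i j} &
    {in A, forall i, exists j, [/\ j \in D, meet j i & rho i <= rho j]}].
Proof.
move=> mxx msym; have [n] := ubnP #|A|; elim: n A => // n IHn A An.
have [->|[i1 Ai1]] := set_0Vmem A.
  by exists (finset.set0); split; rewrite ?finset.sub0set // => i; rewrite inE.
have [j Aj maxj] := @Order.TotalTheory.arg_maxP _ _ _ i1 (mem A) rho Ai1; have {}Aj : j \in A := Aj.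
pose A' := (A :\: [set i | meet j i])%SET.
have A'A : (#|A'| < n)%N.
  rewrite -ltnS; apply: leq_trans An; rewrite ltnS; apply: proper_card.
  by apply/properP; split; [exact: finset.subsetDl|exists j => //; rewrite !inE mxx].
have [D [DA' Dd Dc]] := IHn _ A'A.
have Dj i : i \in D -> ~~ meet j i.
  by move=> /(fintype.subsetP DA'); rewrite !inE => /andP[].
exists (j |: D)%SET; split.
- rewrite finset.subUset finset.sub1set Aj /=; apply: (fintype.subset_trans DA'); exact: finset.subsetDl.
- move=> x y; rewrite !inE => /orP[/eqP->|xD] /orP[/eqP->|yD].
  + by rewrite eqxx.
  + by move=> _; exact: Dj.
  + by move=> _; rewrite msym; exact: Dj.
  + exact: Dd.
- move=> i Ai; have [ji|ji] := boolP (meet j i).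
    by exists j; split => //; rewrite ?inE ?eqxx //; exact: maxj.
  have [|k [kD ki rik]] := Dc i; first by rewrite !inE ji Ai.
  by exists k; split => //; rewrite inE kD orbT.
Qed.

Lemma sum_disjoint_le (I P : finType) (S : I -> pred P) (nu : P -> R)
    (D : {set I}) : (forall b, 0 <= nu b) ->
  {in D &, forall i j, i != j -> ~~ [exists b, S i b && S j b]} ->
  \sum_(i in D) \sum_(b | S i b) nu b <= \sum_b nu b.
Proof.
move=> nu0 dis; rewrite (exchange_big_dep xpredT) //=; apply: ler_sum => b _.
have [[i iD Sib]|none] := pselect (exists2 i, i \in D & S i b).
  rewrite (bigD1 i) ?iD //= big1 ?addr0 // => j /andP[/andP[jD Sjb] ji].
  move: (dis _ _ jD iD ji) => /negP[]; apply/existsP; exists b.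
  by rewrite Sjb Sib.
by rewrite big1 // => i /andP[iD Sib]; case: none; exists i.
Qed.

(** With weights w = rho^sigma, the balls saturated by a maximal packing nu cover
    the net. A Vitali subfamily of them is disjoint, and its fourfold enlargements
    cover the space, so that the covering hypothesis gives
    1 <= sum (8 rho)^sigma = 8^sigma sum nu(ball) <= 8^sigma nu(total).
    Normalizing nu therefore costs a factor 8^sigma. *)
Lemma finite_frostman (X : Type) (D : X -> X -> R) (P K : finType)
    (x : P -> X) (rho : K -> R) (sigma delta eta : R) (k0 : K) :
  (forall y, D y y = 0) -> (forall y z, D y z = D z y) ->
  (forall u y z, D y z <= D y u + D u z) ->
  (forall y, exists b, D y (x b) <= eta) ->
  (forall k, [/\ 0 < rho k, eta <= rho k & 8 * rho k < delta]) ->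
  (forall (J : finType) (A : {set J}) (E : J -> set X) (a : J -> R),
     (forall j, 0 < a j < delta) ->
     (forall j y z, E j y -> E j z -> D y z <= a j) ->
     (forall y, exists2 j, j \in A & E j y) ->
     1 <= \sum_(j in A) a j `^ sigma) ->
  exists nu : P -> R, [/\ forall b, 0 <= nu b, \sum_b nu b = 1 &
    forall b k, \sum_(b' | D (x b) (x b') <= rho k) nu b' <=
       (8 * rho k) `^ sigma].
Proof.
move=> Dxx Dsym Dtri net rhoP cover.
pose S (i : P * K) : pred P := fun b => D (x i.1) (x b) <= rho i.2.
pose w (i : P * K) := rho i.2 `^ sigma.
have Sb b k : S (b, k) b by rewrite /S /= Dxx; have [/ltW] := rhoP k.
have [nu [nu0 nuw tight]] := @greedy_packing _ _ S w
   (fun=> powR_ge0 _ _) (fun b => ex_intro _ (b, k0) (Sb b k0)).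
pose meet (i j : P * K) := [exists b, S i b && S j b].
have mrefl : reflexive meet.
  by move=> [b k]; apply/existsP; exists b; rewrite Sb.
have msym : symmetric meet.
  by move=> i j; apply: eq_existsb => b; rewrite andbC.
have [F [FA Fd Fc]] := vitali_selection (fun i => rho i.2)
  [set i | \sum_(b | S i b) nu b == w i]%SET mrefl msym.
have F1 : 1 <= \sum_(j in F) (8 * rho j.2) `^ sigma.
  apply: (cover _ F (fun j => [set y | D (x j.1) y <= 4 * rho j.2])).
  - move=> j; have [r0 _ ->] := rhoP j.2; rewrite andbT mulr_gt0 //.
  - move=> j y z /= yE zE; apply: le_trans (Dtri (x j.1) _ _) _.
    by rewrite Dsym; lra.
  - move=> y; have [b yb] := net y; have [i Sib ti] := tight b.
    have [|j [jF ji rij]] := Fc i; first by rewrite inE ti eqxx.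
    exists j => //=; case/existsP: ji => b' /andP[].
    rewrite /S in Sib *; move=> jb' ib'.
    have [_ ei _] := rhoP i.2.
    have h1 := Dtri (x b') (x j.1) y.
    have h2 := Dtri (x i.1) (x b') y.
    have h3 := Dtri (x b) (x i.1) y.
    rewrite (Dsym (x b') (x i.1)) in h2; rewrite (Dsym (x b) y) in h3.
    by lra.
have tot : 8 `^ (- sigma) <= \sum_b nu b.
  apply: le_trans (sum_disjoint_le nu0 Fd).
  rewrite powRN -div1r ler_pdivrMr ?powR_gt0 // mulrC mulr_sumr.
  apply: le_trans F1 _; rewrite le_eqVlt; apply/orP; left; apply/eqP.
  apply: eq_bigr => j jF; rewrite powRM ?ler0n //; last by have [/ltW] := rhoP j.2.
  by have := fintype.subsetP FA _ jF; rewrite inE => /eqP ->.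
have tot0 : 0 < \sum_b nu b by apply: lt_le_trans tot; rewrite powR_gt0.
exists (fun b => nu b / \sum_b nu b); split.
- by move=> b; rewrite divr_ge0 // ltW.
- by rewrite -mulr_suml divff // gt_eqF.
- move=> b k; rewrite -mulr_suml ler_pdivrMr //.
  apply: le_trans (nuw (b, k)) _; rewrite /w /= powRM ?ler0n //; last first.
    by have [/ltW] := rhoP k.
  rewrite mulrAC ler_peMl ?powR_ge0 //.
  by rewrite -ler_pdivrMl ?powR_gt0 // mulr1 -powRN.
Qed.

End finite_frostman.

(** * From mean balls to sets of small dynamical diameter *)

Section mean_ball.
Context {R : realType}.

(** Each point of the mean ball is encoded by the coordinates at which it is far
    from y, together with a piece of the cover for each of these coordinates. Two
    points with the same code stay 2 a-close at all times, so each code accounts for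
    mass at most w. The codes are counted with the weight 1 / M per far coordinate:
    the weights of all codes sum to 2^N, and a code that occurs has weight at least
    M^-q because at most q coordinates are far. *)
Lemma mean_ball_mass (X : Type) (d : X -> X -> R) (N M : nat) (P : finType)
    (nu : P -> R) (z : P -> 'I_N -> X) (y : 'I_N -> X) (V : 'I_M -> set X)
    (a q w : R) :
  (forall u v, 0 <= d u v) ->
  (forall u v, d u v = d v u) -> (forall u v t, d u v <= d u t + d t v) ->
  0 < a -> (0 < M)%N ->
  (forall i u v, V i u -> V i v -> d u v <= a) -> (forall u, exists i, V i u) ->
  (forall E : pred P, (forall b b', E b -> E b' ->
      forall n, d (z b n) (z b' n) <= 2 * a) -> \sum_(b | E b) nu b <= w) ->
  \sum_(b | \sum_n d (z b n) (y n) <= q * a) nu b <=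
    2 ^+ N * M%:R `^ q * w.
Proof.
move=> d0 dsym dtri a0 M0 Vdiam Vcov small.
have w0 : 0 <= w by have := small pred0; rewrite big_pred0 //; apply.
have MR : 0 < M%:R :> R by rewrite ltr0n.
(* kap b is the code of b; the value None marks the times at which b is close to y *)
pose kap b : {ffun 'I_N -> option 'I_M} :=
  [ffun n => if d (z b n) (y n) <= a then None else [pick i | `[< V i (z b n) >]]].
pose om (o : option 'I_M) : R := if o is Some _ then M%:R^-1 else 1.
pose Om (k : {ffun 'I_N -> option 'I_M}) : R := \prod_n om (k n).
have kapP b n : a < d (z b n) (y n) -> exists2 i, kap b n = Some i & V i (z b n).
  rewrite ltNge ffunE => /negbTE ->; case: pickP => [i /asboolP Vi|none].
    by exists i.
  by have [i Vi] := Vcov (z b n); have /asboolP := none i.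
have OmE (k : {ffun 'I_N -> option 'I_M}) : Om k = M%:R ^- #|[pred n | k n]|.
  rewrite /Om (bigID (fun n => isSome (k n))) /= [X in _ * X]big1 ?mulr1.
    rewrite -prodr_const -prodfV big_mkcond [in RHS]big_mkcond /=.
    by apply: eq_bigr => n _; rewrite inE /om; case: (k n).
  by move=> n; rewrite /om; case: (k n).
rewrite (partition_big kap xpredT) //=.
have -> : 2 ^+ N * M%:R `^ q * w = \sum_k (w * M%:R `^ q * Om k).
  rewrite -mulr_sumr /Om -(bigA_distr_bigA (fun=> om)) /= prodr_const card_ord.
  have -> : \sum_(o : option 'I_M) om o = 2.
    rewrite (bigD1 None) //= (reindex_omap Some id) => [|[]//].
    under eq_bigl do rewrite /= eqxx.
    by rewrite sumr_const card_ord -[_ *+ M]mulr_natl divff ?gt_eqF.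
  by ring.
apply: ler_sum => k _.
have [[b0 /andP[bq kb]]|none] := pselect (exists b,
    (\sum_n d (z b n) (y n) <= q * a) && (kap b == k)); last first.
  rewrite big_pred0 => [|b]; last by apply/negbTE/negP => h; apply: none; exists b.
  rewrite !mulr_ge0 ?powR_ge0 //; apply: prodr_ge0 => n _.
  by rewrite /om; case: (k n); rewrite ?invr_ge0.
apply: (@le_trans _ _ w).
  apply: small => b b' /andP[_ /eqP kb1] /andP[_ /eqP kb2] n.
  have [h1|/kapP[i ki Vi]] := leP (d (z b n) (y n)) a.
    have [h2|/kapP[i ki Vi]] := leP (d (z b' n) (y n)) a.
      have := dtri (z b n) (z b' n) (y n); rewrite (dsym (y n)); lra.
    by move: ki; rewrite kb2 -kb1 ffunE h1.
  have [h2|/kapP[i' ki' Vi']] := leP (d (z b' n) (y n)) a.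
    by move: ki; rewrite kb1 -kb2 ffunE h2.
  move: ki'; rewrite kb2 -kb1 ki => -[ii']; subst i'.
  by have := Vdiam _ _ _ Vi Vi'; lra.
rewrite -mulrA ler_peMr // OmE ler_pdivlMr ?exprn_gt0 // mul1r -powR_mulrn //.
rewrite ler_powR ?ler1n // -(ler_pM2r a0); apply: le_trans bq.
rewrite mulr_natl -sumr_const big_mkcond /=; apply: ler_sum => n _.
rewrite inE -(eqP kb); case: ifPn => // kn; apply: ltW; rewrite ltNge.
by apply: contraL kn => h; rewrite ffunE h.
Qed.

End mean_ball.

(** * From finitely additive limits to Borel measures *)

Section exhaustion.
Context {R : realType} {X : metricType R}.

(** Shrinking W by 1 / (n + 1) gives the sets; expressing the shrinking through
    balls contained in W avoids the distance to a possibly empty complement. *)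
Lemma open_exhaustion (W : set X) : open W ->
  exists Wn : nat -> set X, [/\ forall n, open (Wn n),
    forall n, closure (Wn n) `<=` Wn n.+1 & \bigcup_n Wn n = W].
Proof.
move=> oW.
pose V (r : R) := [set x : X | exists2 r', r < r' & ball x r' `<=` W].
have Vshift r s x y : s <= r -> V r y -> ball x ((r - s) / 2) y -> V s x \/ r = s.
  move=> sr [r' rr' yW] xy; have [<-|rs] := eqVneq r s; first by right.
  have {sr rs} rs : s < r by rewrite lt_neqAle eq_sym rs sr.
  left; exists (r' - (r - s) / 2); first by lra.
  move=> z xz; apply: yW; have := ball_triangle (ball_sym xy) xz.
  by apply: le_ball; lra.
have oV r : open (V r).
  rewrite openE => x [r' rr' xW].
  apply/nbhs_ballP; exists ((r' - r) / 2) => /=; first by rewrite divr_gt0 ?subr_gt0.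
  move=> y xy; exists (r' - (r' - r) / 2); first by lra.
  move=> z yz; apply: xW; have := ball_triangle xy yz.
  by apply: le_ball; lra.
exists (fun n => V n.+1%:R^-1); split; first by move=> n; exact: oV.
- move=> n x clx.
  have lt12 : n.+2%:R^-1 < n.+1%:R^-1 :> R by rewrite ltf_pV2 ?posrE ?ltr0n ?ltr_nat.
  have [|y [yV xy]] := clx (ball x ((n.+1%:R^-1 - n.+2%:R^-1) / 2)).
    by apply: nbhsx_ballx; rewrite divr_gt0 ?subr_gt0.
  by case: (Vshift _ _ _ _ (ltW lt12) yV xy) => // eq12; rewrite eq12 ltxx in lt12.
- apply/seteqP; split => [x [n _ [r' rr' xW]]|x Wx].
    by apply: xW; apply: ballxx; apply: le_lt_trans rr'; rewrite invr_ge0.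
  have /nbhs_ballP [e /= e0 xe] : nbhs x W by apply: open_nbhs_nbhs.
  have [n ne] := ltr_add_invr (y := 0) e0.
  by exists n => //; exists e => //; rewrite add0r in ne.
Qed.

End exhaustion.

Section finitely_additive.
Context {R : realType} {T : Type} (p : set T -> R).
Hypothesis p_ge0 : forall A, 0 <= p A.
Hypothesis pU : forall A B, A `&` B = set0 -> p (A `|` B) = p A + p B.

Lemma fadd_le A B : A `<=` B -> p A <= p B.
Proof.
move=> AB; rewrite -(setDUK AB) pU ?lerDl //.
by rewrite setDE setICA setICr setI0.
Qed.

Lemma fadd0 : p set0 = 0.
Proof.
have := pU (A := set0) (B := set0); rewrite setI0 setU0 => /(_ erefl).
by move=> h; lra.
Qed.


Lemma fadd_leU A B : p (A `|` B) <= p A + p B.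
Proof.
have -> : A `|` B = A `|` (B `\` A).
  by apply/seteqP; split => x /=; have [|] := pselect (A x); tauto.
rewrite pU; first by rewrite lerD2l; apply: fadd_le; exact: subDsetl.
by rewrite setDE setICA setICr setI0.
Qed.

Lemma fadd_disj_le A B C : A `<=` C -> B `<=` C -> A `&` B = set0 ->
  p A + p B <= p C.
Proof. by move=> AC BC AB; rewrite -pU //; apply: fadd_le; rewrite subUset. Qed.

Lemma fadd_bigcup_le (B : nat -> set T) n :
  p (\big[setU/set0]_(i < n) B i) <= \sum_(i < n) p (B i).
Proof.
elim: n => [|n IHn]; first by rewrite !big_ord0 fadd0.
rewrite !big_ord_recr /=; apply: le_trans (fadd_leU _ _) _.
by rewrite lerD2r.
Qed.

End finitely_additive.

Section outer_extension.
Context {R : realType} {X : metricType R}.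
Variables (x0 : X) (p : set X -> R).
Hypothesis X_compact : compact [set: X].
Hypothesis p_ge0 : forall A, 0 <= p A.
Hypothesis pU : forall A B, A `&` B = set0 -> p (A `|` B) = p A + p B.
Hypothesis pT : p setT = 1.

Local Notation bX := (borel x0).

(** The infinite weight of the other sets makes [mu_ext], whose covers consist of
    measurable sets, the outer measure generated by open covers. *)
Definition open_weight (A : set bX) : \bar R :=
  if `[< @open X A >] then (p A)%:E else +oo%E.

Let star : set bX -> \bar R := mu_ext open_weight.

Let ow0 : open_weight set0 = 0%E.
Proof. by rewrite /open_weight asboolT ?fadd0 //; exact: open0. Qed.

Let ow_ge0 A : (0 <= open_weight A)%E.
Proof. by rewrite /open_weight; case: ifP => _; rewrite ?lee_fin ?leey. Qed.

HB.instance Definition _ := isOuterMeasure.Build R bX star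
  (mu_ext0 ow0 ow_ge0) (mu_ext_ge0 ow_ge0) (le_mu_ext open_weight)
  (mu_ext_sigma_subadditive ow_ge0).

Let measurable_open (A : set X) : open A -> measurable (A : set bX).
Proof. exact: sub_sigma_algebra. Qed.

Let star_ge (A : set X) v :
  (forall B : nat -> set X, (forall k, open (B k)) -> A `<=` \bigcup_k B k ->
    (v <= \sum_(k <oo) (p (B k))%:E)%E) -> (v <= star A)%E.
Proof.
move=> h; apply: le_ereal_inf_tmp => _ [B [mB AB] <-].
have [[k nok]|] := pselect (exists k, ~ @open X (B k)).
  rewrite (eseries_pinfty _ _ (_ : open_weight (B k) = +oo%E)) ?leey //.
    by move=> n _; rewrite gt_eqF // (lt_le_trans _ (ow_ge0 _)).
  by rewrite /open_weight asboolF.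
rewrite -forallNE => oB; have {}oB k : @open X (B k) by exact: contrapT.
under eq_eseriesr do rewrite /open_weight (asboolT (oB _)).
exact: h.
Qed.

Let star_le_cover (A : set X) (B : nat -> set X) :
  (forall k, open (B k)) -> A `<=` \bigcup_k B k ->
  (star A <= \sum_(k <oo) (p (B k))%:E)%E.
Proof.
move=> oB AB; apply: ereal_inf_lbound; exists B.
  by split => // k; exact: measurable_open.
by apply: eq_eseriesr => k _; rewrite /open_weight asboolT.
Qed.

Let nneseries_le_bound (f : nat -> R) (c : R) : (forall n, 0 <= f n) ->
  (forall n, \sum_(i < n) f i <= c) -> (\sum_(k <oo) (f k)%:E <= c%:E)%E.
Proof.
move=> f0 fc; apply: lime_le.
  by apply: is_cvg_nneseries => n _ _; rewrite lee_fin.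
by apply: nearW => n; rewrite big_mkord sumEFin lee_fin.
Qed.

Lemma star_open_le (U : set X) : open U -> (star U <= (p U)%:E)%E.
Proof.
move=> oU; pose B (k : nat) := if k is 0%N then U else set0.
apply: (@le_trans _ _ (\sum_(k <oo) (p (B k))%:E)%E).
  apply: star_le_cover => [[|k] /=|x Ux]; [by []|exact: open0|by exists 0%N].
apply: nneseries_le_bound => // -[|n]; first by rewrite big_ord0.
by rewrite big_ord_recl /= big1 ?addr0 // => i _; rewrite (fadd0 pU).
Qed.

(** By compactness a countable open cover may be replaced by a finite one, to which
    finite subadditivity of p applies. *)
Lemma star_closed_ge (K : set X) : closed K -> ((p K)%:E <= star K)%E.
Proof.
move=> cK; have cptK : compact K by apply: subclosed_compact X_compact _.
apply: star_ge => B oB KB.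
have [n Kn] : exists n, K `<=` \big[setU/set0]_(i < n) B i.
  have [cov _] := compact_near_coveringP K.
  have [|n _ Kn] := cov cptK nat \oo (fun n x => (\big[setU/set0]_(i < n) B i) x) _.
    move=> x /KB [k _ Bkx]; exists (B k, [set n | (k < n)%N]) => /=.
      by split; [apply: open_nbhs_nbhs|exact: nbhs_infty_gt].
    by move=> [y n] /= [By kn]; rewrite -bigcup_mkord; exists k.
  by exists n => x Kx; exact: (Kn n (leqnn n) x Kx).
apply: (@le_trans _ _ (\sum_(0 <= k < n) (p (B k))%:E)%E).
  rewrite big_mkord sumEFin lee_fin; apply: le_trans (fadd_le p_ge0 pU Kn) _.
  exact: (fadd_bigcup_le p_ge0 pU).
by apply: nneseries_lim_ge => k _ _; rewrite lee_fin.
Qed.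

(** Along an exhaustion W_n of W the numbers p(W_n) increase to some alpha, and W
    is covered by W_(n+1) and the open annuli W_(n+k+2) minus the closure of
    W_(n+k), whose p-masses telescope to at most 2 (alpha - p(W_n)). *)
Lemma star_inner (W : set X) (eta : R) : open W -> 0 < eta ->
  exists W' : set X, [/\ open W', closure W' `<=` W &
    (star W <= (p W' + eta)%:E)%E].
Proof.
move=> oW eta0; have [Wn [oWn clW WE]] := open_exhaustion oW.
have Wn1 n : Wn n `<=` Wn n.+1 by apply: subset_trans (clW n); exact: subset_closure.
have Wmono : {homo Wn : m n / (m <= n)%N >-> m `<=` n}.
  move=> m n /subnK <-; elim: (n - m)%N => [//|k IHk].
  exact: subset_trans IHk (Wn1 _).
have WnW n : Wn n `<=` W by rewrite -WE; exact: bigcup_sup.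
pose a n := p (Wn n).
have a_mono : {homo a : m n / (m <= n)%N >-> m <= n}.
  by move=> m n mn; apply: fadd_le => //; exact: Wmono.
have aub : has_ubound (range a).
  by exists 1 => _ [n _ <-]; rewrite -pT; apply: fadd_le.
have asup : has_sup (range a) by split => //; exists (a 0%N), 0%N.
pose alpha := sup (range a).
have a_le n : a n <= alpha by apply: ub_le_sup => //; exists n.
have [_ [n _ <-] an] := sup_adherent (divr_gt0 eta0 (ltr0n _ 3)) asup.
exists (Wn n); split => //; first by apply: subset_trans (clW n) _.
pose F k := if k is k'.+1 then Wn (n + k').+2 `\` closure (Wn (n + k')%N)
  else Wn n.+1.
have oF k : open (F k).
  case: k => [|k] /=; first exact: oWn.
  by rewrite setDE; apply: openI => //; apply: closed_openC; exact: closed_closure.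
have WF : W `<=` \bigcup_k F k.
  move=> x; rewrite -WE => -[m0 _ Wm0x].
  have ex : exists m, `[< Wn m x >] by exists m0; apply/asboolP.
  case: (ex_minnP ex) => m /asboolP Wmx mmin.
  have [mn|mn] := leqP m n.+1; first by exists 0%N => //=; exact: Wmono mn _ Wmx.
  exists (m - n.+1)%N => //; have -> : (m - n.+1 = (m - n.+2).+1)%N by lia.
  rewrite /F; have -> : ((n + (m - n.+2)).+2 = m)%N by lia.
  split=> // /clW/asboolP/mmin; lia.
have pF k : p (F k.+1) <= a (n + k).+2 - a (n + k)%N.
  rewrite lerBrDr.
  apply: (@fadd_disj_le _ _ p p_ge0 pU (F k.+1) (Wn (n + k)%N) (Wn (n + k).+2)).
  - exact: subDsetl.
  - by apply: Wmono; lia.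
  - by rewrite -subset0 => x [[_ +] Wx]; apply; exact: subset_closure.
apply: (le_trans (star_le_cover oF WF)).
apply: nneseries_le_bound => // -[|m]; first by rewrite big_ord0 addr_ge0 // ltW.
rewrite big_ord_recl /=.
(* each annulus overlaps its neighbours, hence the double telescoping *)
have tele : \sum_(i < m) p (F i.+1) <= a (n + m).+1 + a (n + m)%N - a n.+1 - a n.
  elim: m => [|m IHm]; first by rewrite big_ord0 addn0; lra.
  rewrite big_ord_recr /= -addSnnS.
  have := pF m; rewrite /= -addSn; move: IHm; rewrite addSn; lra.
have h1 := a_le (n + m).+1; have h2 := a_le (n + m)%N; have h3 := a_mono _ _ (leqnSn n).
under eq_bigr do rewrite /bump /=.
rewrite -/(a n) -/(a n.+1) in h3 *; rewrite -/alpha in an.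
by move: tele an; rewrite /F -/(a n.+1); lra.
Qed.

(** The part of U outside V is covered by the open set U minus the closure of W,
    where W approximates the part inside V from within; p is additive on these two
    disjoint open sets. *)
Lemma star_split_open (U V : set X) : open U -> open V ->
  (star (U `&` V) + star (U `&` ~` V) <= (p U)%:E)%E.
Proof.
move=> oU oV; apply/lee_addgt0Pr => e e0.
have [W [oW clW sW]] := star_inner (openI oU oV) e0.
have oD : open (U `\` closure W).
  by rewrite setDE; apply: openI => //; apply: closed_openC; exact: closed_closure.
apply: (@le_trans _ _ ((p W + e)%:E + (p (U `\` closure W))%:E)%E).
  apply: leeD => //; apply: le_trans (star_open_le oD).
  apply: le_outer_measure => x [Ux nVx]; split => // /clW [_ Vx]; exact: nVx.
rewrite -!EFinD lee_fin addrAC lerD2r; apply: (@fadd_disj_le _ _ p p_ge0 pU W (U `\` closure W) U).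
- by move=> x /subset_closure /clW [].
- exact: subDsetl.
- by rewrite -subset0 => x [Wx [_]]; apply; exact: subset_closure.
Qed.

Lemma open_caratheodory (V : set X) : open V -> star.-caratheodory V.
Proof.
move=> oV; apply: le_caratheodory_measurable => A; apply: star_ge => B oB AB.
have sub (C : set X) : (star (A `&` C) <= \sum_(k <oo) star (B k `&` C))%E.
  apply: le_trans (outer_measure_sigma_subadditive _ _).
  apply: le_outer_measure => x [/AB [k _ Bx] Cx]; by exists k.
apply: le_trans (leeD (sub V) (sub (~` V))) _.
rewrite -nneseriesD; [|by move=> *; exact: outer_measure_ge0..].
apply: lee_nneseries => k _; last exact: star_split_open.
by rewrite adde_ge0 // outer_measure_ge0.
Qed.

Lemma borel_caratheodory (A : set bX) : measurable A -> star.-caratheodory A.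
Proof.
apply: smallest_sub => [|V oV]; last exact: open_caratheodory.
exact: (sigma_algebra_measurable (caratheodory_type star)).
Qed.

Let star_sigma_additive : semi_sigma_additive star.
Proof.
move=> F mF tF mUF; apply: caratheodory_measure_sigma_additive => //.
  by move=> i; exact: borel_caratheodory.
exact: borel_caratheodory.
Qed.

HB.instance Definition _ := isMeasure.Build _ bX R star
  (outer_measure0 star) (outer_measure_ge0 star) star_sigma_additive.

Let starT : star setT = 1%E.
Proof.
apply/eqP; rewrite eq_le; apply/andP; split.
  by have := star_open_le (@openT X); rewrite pT.
by have := star_closed_ge (@closedT X); rewrite pT.
Qed.

HB.instance Definition _ := Measure_isProbability.Build _ bX R star starT.

(** The sandwich between open and closed sets is all that relates mu to p: the two
    may differ on sets whose frontier is not mu-null. *)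
Lemma borel_extension : exists mu : probability bX R,
  [/\ forall U : set X, open U -> (mu U <= (p U)%:E)%E,
      forall K : set X, closed K -> ((p K)%:E <= mu K)%E &
      forall T : X -> X, homeomorphism T ->
        (forall A, p (T @^-1` A) = p A) -> invariant_measure T mu].
Proof.
exists star; split; [exact: star_open_le|exact: star_closed_ge|].
have half (T : X -> X) (A : set X) : continuous T ->
    (forall A, p (T @^-1` A) = p A) -> (star (T @^-1` A) <= star A)%E.
  move=> cT pTA; apply: star_ge => B oB AB.
  under eq_eseriesr do rewrite -pTA.
  apply: star_le_cover => [k|x /AB [k _ Bx]]; last by exists k.
  by apply: open_comp => // y _; exact: cT.
move=> T [cT [g [cg Tg gT]]] pTA A _; apply/eqP; rewrite eq_le half //=.
have {1}-> : A = g @^-1` (T @^-1` A).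
  by apply/seteqP; split => x /=; rewrite gT.
apply: half => // B; rewrite -pTA; congr p.
by apply/seteqP; split => x /=; rewrite Tg.
Qed.

End outer_extension.

(** * Partitions into sets with null frontier *)

Lemma mdist_continuous {R : realType} {X : metricType R} (x : X) :
  continuous (mdist x : X -> R).
Proof.
move=> y; apply/cvgrPdist_lt => e e0; near=> z.
have yz : mdist y z < e.
  by near: z; have := nbhsx_ballx y _ e0; rewrite ballEmdist.
rewrite (le_lt_trans _ yz) // ler_norml.
have h1 := metric_triangle x y z; have h2 := metric_triangle x z y.
rewrite (metric_sym z y) in h2; lra.
Unshelve. all: by end_near. Qed.

Lemma open_mdist_ball {R : realType} {X : metricType R} (x : X) (r : R) :
  open [set y | mdist x y < r].
Proof.
apply: (@open_comp _ _ (mdist x) [set t | t < r]) => [y _|]; last exact: open_lt.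
exact: mdist_continuous.
Qed.

Section null_spheres.
Context {R : realType} {X : metricType R} (x0 : X) (mu : probability (borel x0) R).

Lemma measurable_mdist (x : X) :
  measurable_fun [set: borel x0] (mdist x : borel x0 -> R).
Proof.
apply: (measurability _ (measurable_realfun.RGenOpens.measurableE R)).
move=> _ [_ [a [b ->]] <-]; rewrite setTI; apply: sub_sigma_algebra.
apply: open_comp; [by move=> y _; exact: mdist_continuous|exact: interval_open].
Qed.

(** The spheres centered at x are the fibres of a real random variable, and only
    countably many of its values are atoms. *)
Lemma null_sphere (x : X) (e : R) : 0 < e ->
  exists r, [/\ 0 < r, r < e & mu [set y | mdist x y = r] = 0%E].
Proof.
move=> e0.
pose f : borel x0 -> R := mdist x.
pose mf := isMeasurableFun.Build _ _ _ _ f (measurable_mdist x).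
pose Y : {mfun borel x0 >-> R} := HB.pack f mf.
apply: contrapT => none.
have sub : `]0, e[%classic `<=` [set r : R | 0 < pmf (P := mu) Y r].
  move=> r /=; rewrite in_itv /= => /andP[r0 re].
  rewrite lt_neqAle pmf_ge0 andbT; apply/eqP => pr; apply: none.
  exists r; split => //; move: pr; rewrite /pmf => /esym/eqP.
  rewrite fine_eq0 ?fin_num_measure //; exact/eqP.
have := sub_countable (subset_card_le sub) (pmf_gt0_countable Y).
move=> /countable_lebesgue_measure0; rewrite lebesgue_measure_itv /= lte_fin e0.
by rewrite oppr0 adde0 => -[] e00; rewrite e00 ltxx in e0.
Qed.

End null_spheres.

Section null_frontier.
Context {R : realType} {X : metricType R} (x0 : X) (mu : probability (borel x0) R).

(** Q and K play the roles of the interior and of the closure; leaving them free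
    makes the stability under Boolean operations immediate. *)
Definition null_frontier (A : set X) : Prop :=
  exists Q K : set X, [/\ open Q, closed K, Q `<=` A, A `<=` K &
    mu (K `\` Q) = 0%E].

Let measurable_open (A : set X) : open A -> measurable (A : set (borel x0)).
Proof. exact: sub_sigma_algebra. Qed.

Let measurable_closed (A : set X) : closed A -> measurable (A : set (borel x0)).
Proof.
by move=> cA; rewrite -[A]setCK; apply: measurableC; apply: measurable_open; exact: closed_openC.
Qed.

Lemma null_frontier_eq (p : set X -> R) (A : set X) :
  {homo p : B C / B `<=` C >-> B <= C} ->
  (forall U, open U -> (mu U <= (p U)%:E)%E) ->
  (forall K, closed K -> ((p K)%:E <= mu K)%E) ->
  measurable (A : set (borel x0)) ->
  null_frontier A -> mu A = (p A)%:E.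
Proof.
move=> pmono pop pcl mA [Q [K [oO cK OA AK KO]]].
have mQ := measurable_open oO; have mK := measurable_closed cK.
have KleO : (mu K <= mu Q)%E.
  rewrite -(setDUK (subset_trans OA AK)); apply: le_trans (measureU2 _ _ _) _ => //.
    exact: measurableD.
  by rewrite [X in (_ + X)%E](KO) adde0.
have muOA : (mu Q <= mu A)%E by apply: le_measure; rewrite ?inE.
have muAK : (mu A <= mu K)%E by apply: le_measure; rewrite ?inE.
apply/eqP; rewrite eq_le; apply/andP; split.
  apply: (le_trans muAK); apply: (le_trans KleO); apply: (le_trans (pop _ oO)).
  by rewrite lee_fin pmono.
apply: le_trans muOA; apply: le_trans KleO; apply: le_trans (pcl _ cK).
by rewrite lee_fin pmono.
Qed.

Let mu0_sub (A B C : set X) : measurable (A : set (borel x0)) ->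
  measurable (B : set (borel x0)) -> measurable (C : set (borel x0)) ->
  C `<=` A `|` B -> mu A = 0%E -> mu B = 0%E -> mu C = 0%E.
Proof.
move=> mA mB mC CAB A0 B0; apply/eqP; rewrite eq_le measure_ge0 andbT.
apply: (@le_trans _ _ (mu (A `|` B))).
  by apply: le_measure; rewrite ?inE //; exact: measurableU.
by apply: le_trans (measureU2 _ mA mB) _; rewrite [X in (X + _)%E]A0 [X in (_ + X)%E]B0 adde0.
Qed.

Let mKO (K O : set X) : closed K -> open O -> measurable (K `\` O : set (borel x0)).
Proof.
by move=> cK oO; apply: measurableD; [exact: measurable_closed|exact: measurable_open].
Qed.

Lemma null_frontierD A B : null_frontier A -> null_frontier B ->
  null_frontier (A `\` B).
Proof.
move=> [Q1 [K1 [oO1 cK1 OA1 AK1 KO1]]] [Q2 [K2 [oO2 cK2 OA2 AK2 KO2]]].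
have oD : open (Q1 `\` K2) by rewrite setDE; apply: openI => //; exact: closed_openC.
have cD : closed (K1 `\` Q2) by rewrite setDE; apply: closedI => //; exact: open_closedC.
exists (Q1 `\` K2), (K1 `\` Q2); split => //.
- by move=> x [/OA1 Ax nx]; split => // /AK2.
- by move=> x [/AK1 Ax nx]; split => // /OA2.
- apply: mu0_sub (mKO cK1 oO1) (mKO cK2 oO2) (mKO cD oD) _ KO1 KO2.
  move=> x [[K1x nO2] h]; have [k2|nk2] := pselect (K2 x); first by right.
  by left; split => // o1; apply: h.
Qed.

Lemma null_frontierU A B : null_frontier A -> null_frontier B ->
  null_frontier (A `|` B).
Proof.
move=> [Q1 [K1 [oO1 cK1 OA1 AK1 KO1]]] [Q2 [K2 [oO2 cK2 OA2 AK2 KO2]]].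
have oD : open (Q1 `|` Q2) by apply: openU.
have cD : closed (K1 `|` K2) by apply: closedU.
exists (Q1 `|` Q2), (K1 `|` K2); split => //.
- exact: setUSS.
- exact: setUSS.
- apply: mu0_sub (mKO cK1 oO1) (mKO cK2 oO2) (mKO cD oD) _ KO1 KO2.
  by move=> x [[Kx|Kx] h]; [left|right]; split => // o; apply: h; [left|right].
Qed.

Lemma null_frontier0 : null_frontier set0.
Proof.
by exists set0, set0; split; [exact: open0|exact: closed0| | |rewrite setD0 measure0].
Qed.

Lemma null_frontier_ball (x : X) (r : R) : mu [set y | mdist x y = r] = 0%E ->
  null_frontier [set y | mdist x y < r].
Proof.
move=> Sr; exists [set y | mdist x y < r], [set y | mdist x y <= r]; split => //.
- exact: open_mdist_ball.
- apply: (@preimage_closed _ _ (mdist x) [set t | t <= r]) => [y _|].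
    exact: mdist_continuous.
  exact: closed_le.
- by move=> y /= /ltW.
- rewrite -[RHS]Sr; congr (mu _); apply/seteqP; split => y /=.
    by move=> [yr /negP]; rewrite -leNgt => ry; apply/eqP; rewrite eq_le yr.
  by move=> ->; rewrite ltxx lexx.
Qed.

End null_frontier.

Lemma compact_finite_subcover (X : topologicalType) (x0 : X) (I : choiceType)
    (U : I -> set X) : compact [set: X] -> (forall i, open (U i)) ->
  (forall x, exists i, U i x) -> exists s : seq I, forall x, exists2 i, i \in s & U i x.
Proof.
move=> Xc oU Ucov.
pose pX : ptopologicalType := HB.pack X (isPointed.Build X x0).
have [D _ Dcov] : @finite_subset_cover I setT pX (U : I -> set pX) setT.
  have : @cover_compact pX setT by rewrite -compact_cover.
  apply => [i _|x _]; first exact: oU.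
  by have [i Ux] := Ucov x; exists i.
exists (finmap.enum_fset D) => x; have [i /= iD Ux] := Dcov x Logic.I.
by exists i.
Qed.

Section null_frontier_partition.
Context {R : realType} {X : metricType R} (x0 : X) (mu : probability (borel x0) R).

Lemma iter_continuous (T : X -> X) n : continuous T -> continuous (iter n T).
Proof.
move=> cT; elim: n => [|n IHn] x; first exact: cvg_id.
exact: (@continuous_comp _ _ _ (iter n T) T) (IHn x) (cT _).
Qed.

Lemma small_iterates (T : X -> X) (m : nat) (x : X) (eta : R) : continuous T -> 0 < eta ->
  exists2 r, 0 < r & forall y, mdist x y < r ->
    forall l, (l < m)%N -> mdist (iter l T x) (iter l T y) < eta.
Proof.
move=> cT eta0; elim: m => [|m [r r0 IHm]]; first by exists 1.
have /cvgrPdist_lt : mdist (iter m T x) (iter m T y) @[y --> x] --> (0 : R).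
  rewrite -(mdistxx (iter m T x)).
  apply: (@continuous_comp _ _ _ (iter m T) (mdist (iter m T x))).
    exact: iter_continuous.
  exact: mdist_continuous.
move=> /(_ _ eta0) /nbhs_ballP [r' /= r'0 sub].
exists (Num.min r r'); first by rewrite lt_min r0.
move=> y; rewrite lt_min => /andP[yr yr'] l; rewrite ltnS leq_eqVlt => /predU1P[->|].
  have := sub y; rewrite ballEmdist /= => /(_ yr').
  by rewrite sub0r normrN ger0_norm // mdist_ge0.
exact: IHm.
Qed.

(** Balls with null spheres cover X; removing from each ball of a finite subcover
    the earlier ones gives the partition. Empty pieces have to be dropped since the
    pieces of a partition are nonempty. *)
Lemma null_frontier_partition (T : X -> X) (m : nat) (eta : R) :
  compact [set: X] -> continuous T -> 0 < eta ->
  exists (k : nat) (F : 'I_k.+1 -> set (borel x0)),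
    [/\ measurable_partition F, forall i, null_frontier mu (F i) &
        forall i x y, F i x -> F i y -> forall l, (l < m)%N ->
          mdist (iter l T x) (iter l T y) < eta].
Proof.
move=> Xc cT eta0.
have eta20 : 0 < eta / 2 by rewrite divr_gt0.
have rad x : exists r, [/\ 0 < r, mu [set y | mdist x y = r] = 0%E & forall y, mdist x y < r ->
    forall l, (l < m)%N -> mdist (iter l T x) (iter l T y) < eta / 2].
  have [r r0 small] := small_iterates m x cT eta20.
  have [r' [r'0 r'r sph]] := null_sphere mu x r0.
  by exists r'; split => // y yr'; apply: small; exact: lt_trans r'r.
have [r rP] := choice rad.
pose U x := [set y | mdist x y < r x].
have oU x : open (U x) by exact: open_mdist_ball.
have [s Dcov] : exists s : seq X, forall x, exists2 c, c \in s & U c x.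
  apply: compact_finite_subcover => // x; exists x.
  by rewrite /U /= mdistxx; have [] := rP x.
pose n := size s.
pose V (i : nat) := U (nth x0 s i).
pose G (i : nat) := V i `\` \big[setU/set0]_(j < i) V j.
have Vn i : null_frontier mu (V i) by apply: null_frontier_ball; have [] := rP (nth x0 s i).
have Gn i : null_frontier mu (G i).
  apply: null_frontierD => //; elim/big_ind : _ => //; first exact: null_frontier0.
  by move=> A B; exact: null_frontierU.
have mV i : measurable (V i : set (borel x0)) by apply: sub_sigma_algebra; exact: oU.
have mG i : measurable (G i : set (borel x0)).
  by apply: measurableD => //; apply: bigsetU_measurable.
have Gsmall i x y : G i x -> G i y -> forall l, (l < m)%N ->
    mdist (iter l T x) (iter l T y) < eta.
  move=> [Vx _] [Vy _] l lm; have [_ _ h] := rP (nth x0 s i).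
  have h1 := h _ Vx _ lm; have h2 := h _ Vy _ lm.
  have := metric_triangle (iter l T x) (iter l T (nth x0 s i)) (iter l T y).
  by rewrite (metric_sym (iter l T x) (iter l T (nth x0 s i))); lra.
have Gcov x : exists2 i, (i < n)%N & G i x.
  have [c cD Ucx] := Dcov x.
  have ex : exists i, `[< V i x >].
    by exists (index c s); apply/asboolP; rewrite /V nth_index.
  have cn : (index c s < n)%N by rewrite index_mem.
  case: (ex_minnP ex) => i /asboolP Vi imin; exists i.
    apply: leq_ltn_trans cn; apply: imin; apply/asboolP.
    by rewrite /V nth_index.
  split => //; rewrite -bigcup_mkord => -[j /= ji Vj].
  have := imin j; rewrite asboolT // => /(_ isT); lia.
have Gtriv i j x : G i x -> G j x -> i = j.
  move=> [Vi ni] [Vj nj]; have [ij|ji|//] := ltngtP i j.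
    by exfalso; apply: nj; rewrite -bigcup_mkord; exists i.
  by exfalso; apply: ni; rewrite -bigcup_mkord; exists j.
pose A := [set i : 'I_n | `[< G i !=set0 >]]%SET.
have GA x : exists2 i : 'I_n, i \in A & G i x.
  have [i iN Gx] := Gcov x; exists (Ordinal iN) => //.
  by rewrite inE; apply/asboolP; exists x.
have [k kA] : exists k, #|A| = k.+1.
  have [i iA _] := GA x0; exists (#|A|).-1; rewrite prednK //.
  by apply/card_gt0P; exists i.
pose idx (i : 'I_k.+1) : 'I_n := enum_val (cast_ord (esym kA) i).
exists k, (fun i => G (idx i)); split => [||i]; [|by []|exact: Gsmall].
split=> //; split.
- apply/seteqP; split => // x _; have [i iA Gx] := GA x.
  exists (cast_ord kA (enum_rank_in iA i)) => //.
  by rewrite /idx cast_ordK enum_rankK_in.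
- move=> i j _ _ [x [Gi Gj]]; have /val_inj/enum_val_inj := Gtriv _ _ _ Gi Gj.
  exact: cast_ord_inj.
- move=> i _; have := enum_valP (cast_ord (esym kA) i); rewrite inE => /asboolP.
  exact.
Qed.

End null_frontier_partition.

(** * Quantization of couplings *)

Section finite_valued.
Context {R : realType} {disp : measure_display} {Omega : measurableType disp}.
Variable P : probability Omega R.

Definition pr (E : set Omega) : R := fine (P E).

Lemma pr_ge0 E : 0 <= pr E.
Proof. exact: fine_ge0. Qed.

Lemma EFin_pr E : measurable E -> (pr E)%:E = P E.
Proof. by move=> mE; rewrite /pr fineK // fin_num_measure. Qed.

Lemma pr_total (B : finType) (W : Omega -> B) (E : set Omega) :
  measurable E -> (forall b, measurable (W @^-1` [set b])) ->
  pr E = \sum_b pr (E `&` W @^-1` [set b]).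
Proof.
move=> mE mW; apply: EFin_inj; rewrite EFin_pr // -sumEFin.
have mEW b : measurable (E `&` W @^-1` [set b]) by apply: measurableI.
under eq_bigr do rewrite EFin_pr //.
have {1}-> : E = \bigcup_(b in [set: B]) (E `&` W @^-1` [set b]).
  by apply/seteqP; split => [w Ew|w [b _ []] //]; exists (W w).
rewrite measure_fin_bigcup //.
  rewrite (fsbigE (index_enum B)) ?index_enum_uniq //.
    by apply: eq_bigl => b; rewrite in_setT.
  by move=> b _; rewrite mem_index_enum.
  exact: finite_finset.
by move=> b b' _ _ [w [[_ /= <-] [_ /= <-]]].
Qed.

Lemma pr_le A B : measurable A -> measurable B -> A `<=` B -> pr A <= pr B.
Proof.
move=> mA mB AB; rewrite -lee_fin !EFin_pr //.
by apply: le_measure; rewrite ?inE.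
Qed.

Lemma fin_mutual_infoE (A B : finType) (Z : Omega -> A) (W : Omega -> B) :
  (forall a, measurable (Z @^-1` [set a])) ->
  (forall b, measurable (W @^-1` [set b])) ->
  fin_mutual_info P Z W =
  \sum_a \sum_b (let pi := pr (Z @^-1` [set a] `&` W @^-1` [set b]) in
    pi * log2 (pi / (pr (Z @^-1` [set a]) * pr (W @^-1` [set b])))).
Proof.
move=> mZ mW.
have mZW a b : measurable (Z @^-1` [set a] `&` W @^-1` [set b]) by apply: measurableI.
rewrite /fin_mutual_info /entropy -!/(pr _).
have -> : \sum_a pr (Z @^-1` [set a]) * log2 (pr (Z @^-1` [set a])) =
    \sum_a \sum_b pr (Z @^-1` [set a] `&` W @^-1` [set b]) *
      log2 (pr (Z @^-1` [set a])).
  by apply: eq_bigr => a _; rewrite -mulr_suml -(pr_total (mZ a) mW).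
have -> : \sum_b pr (W @^-1` [set b]) * log2 (pr (W @^-1` [set b])) =
    \sum_a \sum_b pr (Z @^-1` [set a] `&` W @^-1` [set b]) *
      log2 (pr (W @^-1` [set b])).
  rewrite exchange_big; apply: eq_bigr => b _ /=; rewrite -mulr_suml.
  by under eq_bigr do rewrite setIC; rewrite -(pr_total (mW b) mZ).
have -> : \sum_(x : A * B) pr ((fun w => (Z w, W w)) @^-1` [set x]) *
      log2 (pr ((fun w => (Z w, W w)) @^-1` [set x])) =
    \sum_a \sum_b pr (Z @^-1` [set a] `&` W @^-1` [set b]) *
      log2 (pr (Z @^-1` [set a] `&` W @^-1` [set b])).
  rewrite pair_bigA /=; apply: eq_bigr => -[a b] _ /=.
  suff -> : (fun w => (Z w, W w)) @^-1` [set (a, b)] =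
    Z @^-1` [set a] `&` W @^-1` [set b] by [].
  by apply/seteqP; split => w /=; [case|case=> -> ->].
rewrite opprK -!sumrN -!big_split /=; apply: eq_bigr => a _.
rewrite -!sumrN -!big_split /=; apply: eq_bigr => b _.
set pi := pr (_ `&` _); have [->|pi0] := eqVneq pi 0; first by rewrite !mul0r oppr0 !addr0.
have {}pi0 : 0 < pi by rewrite lt_neqAle eq_sym pi0 pr_ge0.
have a0 : 0 < pr (Z @^-1` [set a]) by apply: lt_le_trans pi0 _; apply: pr_le.
have b0 : 0 < pr (W @^-1` [set b]) by apply: lt_le_trans pi0 _; apply: pr_le.
rewrite log2M ?invr_gt0 ?mulr_gt0 // log2V ?mulr_gt0 // log2M //.
by ring.
Qed.

(** Both integrals are suprema over the simple functions below the integrand, so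
    monotonicity holds for arbitrary functions. It serves to compare the distortion
    of a coupling with that of its quantization. *)
Lemma ge0_le_integral_simple (f1 f2 : Omega -> \bar R) :
  (forall x, (0 <= f1 x)%E) -> (forall x, (f1 x <= f2 x)%E) ->
  (\int[P]_x f1 x <= \int[P]_x f2 x)%E.
Proof.
move=> f10 f12; have f20 x : (0 <= f2 x)%E by apply: le_trans (f12 x).
rewrite !ge0_integralTE //; apply: ereal_sup_le => _ [h hf <-].
by exists h => // x; exact: le_trans (hf x) (f12 x).
Qed.

Lemma expectation_finite_le (A B : finType) (Z : Omega -> A) (W : Omega -> B)
    (phi : A -> B -> R) (g : Omega -> R) (e : R) :
  (forall a, measurable (Z @^-1` [set a])) ->
  (forall b, measurable (W @^-1` [set b])) ->
  (forall a b, 0 <= phi a b) -> (forall w, phi (Z w) (W w) <= g w) ->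
  ('E_P[g] <= e%:E)%E ->
  \sum_a \sum_b pr (Z @^-1` [set a] `&` W @^-1` [set b]) * phi a b <= e.
Proof.
move=> mZ mW phi0 phig Eg; rewrite -lee_fin; apply: le_trans Eg.
have mZW a b : measurable (Z @^-1` [set a] `&` W @^-1` [set b]) by apply: measurableI.
rewrite expectation.unlock.
pose f (x : A * B) w : \bar R :=
  ((phi x.1 x.2)%:E * (\1_(Z @^-1` [set x.1] `&` W @^-1` [set x.2]) w)%:E)%E.
have f0 x w : (0 <= f x w)%E by rewrite mule_ge0 // lee_fin.
have mf (x : A * B) : measurable_fun setT (fun w => f x w : \bar R).
  by apply: measurable_funeM; apply/measurable_EFinP; exact: measurable_indic.
apply: (@le_trans _ _ (\int[P]_w \sum_x f x w)%E).
  rewrite ge0_integral_sum // -sumEFin.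
  rewrite -(pair_bigA _ (fun a b => \int[P]_w f (a, b) w)%E) /=.
  apply: lee_sum => a _; rewrite -sumEFin; apply: lee_sum => b _.
  rewrite /f /= ge0_integralZl //; last 2 first.
  - by apply/measurable_EFinP; exact: measurable_indic.
  - by rewrite lee_fin.
  rewrite integral_indic // setIT EFinM EFin_pr // muleC.
  exact: lexx.
apply: ge0_le_integral_simple => w; first by apply: sume_ge0.
rewrite (bigD1 (Z w, W w)) //= big1 ?adde0.
  rewrite /f /= indicE mem_set //= mule1 lee_fin; exact: phig.
move=> [a b] /eqP ab; rewrite /f /= indicE memNset ?mule0 //= => -[za wb].
by apply: ab; rewrite za wb.
Qed.

End finite_valued.

Lemma cellP {disp : measure_display} {S : measurableType disp} (k : nat)
    (F : 'I_k.+1 -> set S) (x : S) (i : 'I_k.+1) :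
  measurable_partition F -> cell F x = i <-> F i x.
Proof.
move=> [[Fcov Ftriv _] _]; have [j _ Fj] : (\bigcup_i F i) x.
  by have : [set: S] x by []; rewrite -Fcov.
have Fcell : F (cell F x) x.
  by rewrite /cell; case: xgetP => [i' _ //|/(_ j)]; case.
split=> [<- //|Fi]; apply: (Ftriv _ _ Logic.I Logic.I).
by exists x.
Qed.

Lemma cell_preimage {disp : measure_display} {S : measurableType disp} (k : nat)
    (F : 'I_k.+1 -> set S) (i : 'I_k.+1) :
  measurable_partition F -> cell F @^-1` [set i] = F i.
Proof. by move=> pF; apply/seteqP; split => x /(cellP x i pF). Qed.

Section kernel_of_joint.
Context {R : realType} {A B : finType} (pi : A -> B -> R).
Hypothesis pi0 : forall a b, 0 <= pi a b.
Hypothesis pi1 : \sum_a \sum_b pi a b = 1.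

Let alpha a := \sum_b pi a b.
Let beta b := \sum_a pi a b.

(** The conditional law of b given a. At points a of mass zero it is chosen to be
    beta, so that it is always a probability absolutely continuous with respect to
    beta. *)
Definition cond_kernel a b := if alpha a == 0 then beta b else pi a b / alpha a.

Let alpha0 a : 0 <= alpha a. Proof. exact: sumr_ge0. Qed.
Let beta0 b : 0 <= beta b. Proof. exact: sumr_ge0. Qed.

Lemma sum_marginal : \sum_b beta b = 1.
Proof. by rewrite exchange_big. Qed.

Lemma cond_kernel_ge0 a b : 0 <= cond_kernel a b.
Proof. by rewrite /cond_kernel; case: ifP => // _; rewrite divr_ge0. Qed.

Lemma sum_cond_kernel a : \sum_b cond_kernel a b = 1.
Proof.
rewrite /cond_kernel; have [_|a0] := eqVneq (alpha a) 0; first exact: sum_marginal.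
by transitivity (alpha a / alpha a); [rewrite /alpha mulr_suml|rewrite divff].
Qed.

Lemma pi_kernel a b : pi a b = alpha a * cond_kernel a b.
Proof.
rewrite /cond_kernel; case: ifPn => [/eqP a0|a0]; last by rewrite mulrC divfK.
rewrite a0 mul0r; apply/eqP; rewrite eq_le pi0 andbT -a0 /alpha (bigD1 b) //=.
by rewrite lerDl; apply: sumr_ge0.
Qed.

Lemma cond_kernel_gt0 a b : 0 < cond_kernel a b -> 0 < beta b.
Proof.
rewrite /cond_kernel; case: ifPn => // a0 h.
have : 0 < pi a b.
  rewrite lt_neqAle pi0 andbT; apply/eqP => p0.
  by move: h; rewrite -p0 mul0r ltxx.
move/lt_le_trans; apply; rewrite /beta (bigD1 a) //= lerDl.
exact: sumr_ge0.
Qed.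

Lemma joint_information :
  \sum_a \sum_b pi a b * log2 (pi a b / (alpha a * beta b)) =
  \sum_a alpha a * \sum_b cond_kernel a b * log2 (cond_kernel a b / beta b).
Proof.
apply: eq_bigr => a _; rewrite mulr_sumr; apply: eq_bigr => b _.
rewrite mulrA -pi_kernel; have [->|pab] := eqVneq (pi a b) 0; first by rewrite !mul0r.
congr (_ * log2 _); rewrite {1}pi_kernel.
have a0 : alpha a != 0 by apply: contraNneq pab => a0; rewrite pi_kernel a0 mul0r.
by rewrite invfM mulrACA divff // mul1r.
Qed.

End kernel_of_joint.

Section discretization.
Context {R : realType} {X : metricType R} (x0 : X) (T : X -> X).
Context (mu : probability (borel x0) R) (m : nat).
Context {disp : measure_display} {Omega : measurableType disp}.
Context (P : probability Omega R).
Variables (Z : {RV P >-> borel x0}) (Y : {RV P >-> m.-tuple (borel x0)}).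
Variables (k : nat) (F : 'I_k.+1 -> set (borel x0)) (c : 'I_k.+1 -> X).
Variables (eps eta : R).
Hypothesis m0 : (0 < m)%N.
Hypothesis lawZ : forall A : set (borel x0), measurable A -> P (Z @^-1` A) = mu A.
Hypothesis pF : measurable_partition F.
Hypothesis Fc : forall i, F i (c i).
Hypothesis Fsmall : forall i x y, F i x -> F i y -> forall l, (l < m)%N ->
  mdist (iter l T x) (iter l T y) < eta.
Hypothesis cost : ('E_P[fun w => m%:R^-1 *
  \sum_(n < m) mdist (iter n T (Z w)) (tnth (Y w) n)]%R <= (eps - 3 * eta)%:E)%E.

(** Y is quantized coordinate by coordinate with the partition used for Z, a word of
    cells being represented by the word of their chosen points. Mutual information
    can only decrease, being a supremum over partitions, and the distortion moves by
    at most 2 eta per coordinate; of the slack 3 eta, one eta is kept for the later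
    comparison between a point and the representative of its cell. *)
Lemma discretize_coupling :
  exists (l : nat) (dec : 'I_l.+1 -> 'I_m -> 'I_k.+1) (W : 'I_k.+1 -> 'I_l.+1 -> R)
         (q : 'I_l.+1 -> R),
    [/\ [/\ forall i b, 0 <= W i b, forall i, \sum_b W i b = 1,
        forall b, 0 <= q b, \sum_b q b = 1 & forall i b, 0 < W i b -> 0 < q b],
      ((\sum_i fine (mu (F i)) * \sum_b W i b * log2 (W i b / q b))%:E <=
        mutual_info Z Y)%E &
      \sum_i fine (mu (F i)) * (\sum_b W i b *
        \sum_(n < m) mdist (iter n T (c i)) (c (dec b n))) + m%:R * eta <= m%:R * eps].
Proof.
pose B := {ffun 'I_m -> 'I_k.+1}.
have [l lB] : exists l, #|B| = l.+1.
  exists #|B|.-1; rewrite prednK //; apply/card_gt0P.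
  by exists [ffun=> ord0].
pose decf (b : 'I_l.+1) : B := enum_val (cast_ord (esym lB) b).
pose G (b : 'I_l.+1) : set (m.-tuple (borel x0)) :=
  [set t | forall n, F (decf b n) (tnth t n)].
have mF i : measurable (F i) by case: pF.
have mG b : measurable (G b).
  have -> : G b = \bigcap_(n in [set: 'I_m]) ((fun t => tnth t n) @^-1` (F (decf b n))).
    by apply/seteqP; split => t h n; [move=> _; exact: h|exact: h].
  apply: fin_bigcap_measurable => [|n _]; first exact: finite_finset.
  by rewrite -[X in measurable X]setTI; apply: measurable_tnth.
have pG : measurable_partition G.
  split=> //; split.
  - apply/seteqP; split => // t _.
    pose f : B := [ffun n => cell F (tnth t n)].
    exists (cast_ord lB (enum_rank f)) => // n.
    rewrite /decf cast_ordK enum_rankK /f ffunE.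
    exact/(cellP _ _ pF).
  - move=> b b' _ _ [t [Gt Gt']]; apply: (@cast_ord_inj _ _ (esym lB)).
    apply: enum_val_inj; apply/ffunP => n.
    by rewrite -!/(decf _) -((cellP _ _ pF).2 (Gt n)) -((cellP _ _ pF).2 (Gt' n)).
  - move=> b _; exists [tuple c (decf b n) | n < m] => n.
    by rewrite tnth_mktuple.
pose Z' := cell F \o Z; pose Y' := cell G \o Y.
have EZ i : Z' @^-1` [set i] = Z @^-1` (F i).
  by rewrite /Z' comp_preimage (cell_preimage _ pF).
have EY b : Y' @^-1` [set b] = Y @^-1` (G b).
  by rewrite /Y' comp_preimage (cell_preimage _ pG).
have mZ i : measurable (Z' @^-1` [set i]) by rewrite EZ; exact: (measurable_funPTI Z).
have mY b : measurable (Y' @^-1` [set b]) by rewrite EY; exact: (measurable_funPTI Y).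
have mZY i b : measurable (Z' @^-1` [set i] `&` Y' @^-1` [set b]) by apply: measurableI.
pose pi i b := pr P (Z' @^-1` [set i] `&` Y' @^-1` [set b]).
have pi0 i b : 0 <= pi i b by exact: pr_ge0.
have alphaE i : \sum_b pi i b = fine (mu (F i)).
  by rewrite -(pr_total P (mZ i) mY) /pr EZ lawZ.
have betaE b : \sum_i pi i b = pr P (Y' @^-1` [set b]).
  by under eq_bigr do rewrite /pi setIC; rewrite -(pr_total P (mY b) mZ).
have pi1 : \sum_i \sum_b pi i b = 1.
  under eq_bigr do rewrite -(pr_total P (mZ _) mY).
  transitivity (pr P [set: Omega]); last by rewrite /pr probability_setT.
  by rewrite (pr_total P measurableT mZ); apply: eq_bigr => i _; rewrite setTI.
exists l, (fun b n => decf b n), (cond_kernel pi), (fun b => \sum_i pi i b).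
split.
- split.
  + exact: cond_kernel_ge0.
  + exact: sum_cond_kernel.
  + by move=> b; exact: sumr_ge0.
  + exact: sum_marginal.
  + exact: cond_kernel_gt0.
- under eq_bigr do rewrite -alphaE.
  rewrite -(joint_information pi0); apply: ereal_sup_ubound.
  exists k, l, F, G; split => //; congr (_ %:E).
  rewrite -/Z' -/Y' fin_mutual_infoE //.
  apply: eq_bigr => i _; apply: eq_bigr => b _ /=.
  by rewrite betaE -(pr_total P (mZ i) mY).
- pose D i b := \sum_(n < m) mdist (iter n T (c i)) (c (decf b n)).
  have mR : 0 < m%:R :> R by rewrite ltr0n.
  pose phi i b := Num.max 0 (m%:R^-1 * D i b - 2 * eta).
  have phig w : phi (Z' w) (Y' w) <=
      m%:R^-1 * \sum_(n < m) mdist (iter n T (Z w)) (tnth (Y w) n).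
    rewrite ge_max; apply/andP; split.
      by rewrite mulr_ge0 ?invr_ge0 ?(ltW mR) // sumr_ge0 // => n _; exact: mdist_ge0.
    have FZ : F (Z' w) (Z w) by apply/(cellP _ _ pF).
    have GY : G (Y' w) (Y w) by apply/(cellP _ _ pG).
    rewrite lerBlDr -(ler_pM2l mR) mulrDr !mulrA divff ?gt_eqF // !mul1r.
    rewrite -[m in m%:R * 2](card_ord m) -sum1_card natr_sum !mulr_suml -big_split /=.
    apply: ler_sum => n _; rewrite mul1r.
    have h1 := Fsmall (Fc (Z' w)) FZ (ltn_ord n).
    have h2 := Fsmall (GY n) (Fc (decf (Y' w) n)) m0.
    have h3 := metric_triangle (iter n T (c (Z' w))) (iter n T (Z w)) (c (decf (Y' w) n)).
    have h4 := metric_triangle (iter n T (Z w)) (tnth (Y w) n) (c (decf (Y' w) n)).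
    rewrite /= in h2; lra.
  have phi0 i b : 0 <= phi i b by rewrite le_max lexx.
  have := expectation_finite_le mZ mY phi0 phig cost.
  have le1 : \sum_i \sum_b pi i b * (m%:R^-1 * D i b - 2 * eta) <=
      \sum_i \sum_b pi i b * phi i b.
    apply: ler_sum => i _; apply: ler_sum => b _; rewrite ler_wpM2l //.
    by rewrite le_max lexx orbT.
  move=> /(le_trans le1).
  have -> : \sum_i \sum_b pi i b * (m%:R^-1 * D i b - 2 * eta) =
      m%:R^-1 * (\sum_i \sum_b pi i b * D i b) - 2 * eta.
    under eq_bigr do under eq_bigr do rewrite mulrBr mulrCA.
    under eq_bigr do rewrite sumrB -mulr_sumr -mulr_suml.
    by rewrite sumrB -mulr_sumr -mulr_suml pi1 mul1r.
  have -> : \sum_i fine (mu (F i)) * (\sum_b cond_kernel pi i b *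
      \sum_(n < m) mdist (iter n T (c i)) (c (decf b n))) = \sum_i \sum_b pi i b * D i b.
    apply: eq_bigr => i _; rewrite -alphaE mulr_sumr; apply: eq_bigr => b _.
    by rewrite mulrA -pi_kernel.
  rewrite lerBlDr -(ler_pM2l mR) mulrA divff ?gt_eqF // mul1r.
  lra.
Qed.

End discretization.

(** * Ultrafilter limits of orbit averages *)

(** An ultrafilter converges to each of its cluster points. *)
Lemma ultra_cvg_bounded {R : realType} (I : Type) (U : set_system I) (a b : R)
    (f : I -> R) : UltraFilter U -> U [set i | a <= f i <= b] ->
  exists l : R, f @ U --> l.
Proof.
move=> UU fab.
have [l [_ clus]] : `[a, b]%classic `&` cluster (f @ U) !=set0.
  apply: segment_compact; rewrite /fmap /=.
  by apply: filterS fab => i /=; rewrite in_itv.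
exists l => V Vl; have [//|nV] := in_ultra_setVsetC (f @^-1` V) UU.
have [x [nVx Vx]] := clus (~` V) V nV Vl.
by case: nVx.
Qed.

(** The last clause transports the asymptotic inequalities satisfied by mun along G
    to the limit; only finitely many sets occur in each of them. *)
Lemma ultra_mean_limit {R : realType} (X : Type) (T : X -> X) (G : set nat)
    (mun : nat -> set X -> R) :
  (forall n, exists2 N, (n <= N)%N & G N) ->
  (forall N A, G N -> 0 <= mun N A) ->
  (forall N, G N -> mun N setT = 1) ->
  (forall N A B, G N -> A `&` B = set0 -> mun N (A `|` B) = mun N A + mun N B) ->
  (forall N A, G N -> `|mun N (T @^-1` A) - mun N A| <= 2 / N%:R) ->
  exists p : set X -> R, [/\ forall A, 0 <= p A, p setT = 1,
    forall A B, A `&` B = set0 -> p (A `|` B) = p A + p B,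
    forall A, p (T @^-1` A) = p A &
    forall (k : nat) (A : 'I_k -> set X) (f : 'I_k -> R) (l : R),
      (forall e, 0 < e -> exists N0, forall N, (N0 <= N)%N -> G N ->
         l - e <= \sum_i f i * mun N (A i)) ->
      l <= \sum_i f i * p (A i)].
Proof.
move=> Ginf mun0 mun1 munU munT.
have FF : ProperFilter (within G \oo).
  split; last exact: within_filter.
  by move=> [n _ h]; have [N nN GN] := Ginf n; exact: (h N nN GN).
have [U [UU FU]] := ultraFilterLemma FF.
have PU : ProperFilter U by exact: ultra_proper.
have UG (P : nat -> Prop) : (exists N0, forall N, (N0 <= N)%N -> G N -> P N) ->
    \forall N \near U, P N.
  by move=> [N0 h]; apply: FU; exists N0 => // N /= + GN; move/h; apply.
have lim_ex A : exists l : R, mun N A @[N --> U] --> l.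
  apply: (@ultra_cvg_bounded _ _ U 0 1); apply: UG; exists 0%N => N _ GN /=.
  rewrite mun0 //= -(mun1 _ GN) -(setUv A) munU ?setICr //.
  by rewrite lerDl mun0.
have [p pP] := choice lim_ex.
exists p; split.
- move=> A; apply: (cvgr_to_ge (pP A)); apply: UG; exists 0%N => N _; exact: mun0.
- apply/eqP; rewrite eq_le; apply/andP; split.
    apply: (cvgr_to_le (pP setT)); apply: UG; exists 0%N => N _ /mun1 ->.
    exact: lexx.
  apply: (cvgr_to_ge (pP setT)); apply: UG; exists 0%N => N _ /mun1 ->.
  exact: lexx.
- move=> A B AB.
  have h : mun N A + mun N B @[N --> U] --> p (A `|` B).
    apply: cvg_trans (pP (A `|` B)); apply: near_eq_cvg.
    by apply: UG; exists 0%N => N _ GN; rewrite munU.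
  apply: (cvg_unique (@Rhausdorff R) h); exact: cvgD.
- move=> A; apply/eqP; rewrite -subr_eq0 -normr_le0; apply/ler_addgt0Pr => e e0.
  rewrite add0r.
  have h : `|mun N (T @^-1` A) - mun N A| @[N --> U] --> `|p (T @^-1` A) - p A|.
    by apply: cvg_norm; apply: cvgB.
  apply: (cvgr_to_le h); apply: UG.
  exists (Num.truncn (2 / e)).+1 => N Ne GN; apply: le_trans (munT _ _ GN) _.
  have N0 : 0 < N%:R :> R by rewrite ltr0n; lia.
  rewrite ler_pdivrMr // mulrC -ler_pdivrMr //; apply: ltW.
  by apply: lt_le_trans (truncnS_gt _) _; rewrite ler_nat.
- move=> k A f l fl; apply/ler_addgt0Pr => e e0; rewrite -lerBlDr.
  have h : \sum_i f i * mun N (A i) @[N --> U] --> \sum_i f i * p (A i).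
    by apply: cvg_big => [|i _]; [exact: add_continuous|apply: cvgMr; exact: pP].
  by apply: (cvgr_to_ge h); apply: UG; exact: fl.
Qed.

(** * Block codes along orbits *)

Section orbit_mean.
Context {R : realType} {X : Type} (T : X -> X) (N : nat) {P : finType}.
Variables (x : P -> X) (nu : P -> R).

Definition orbit_mean (A : set X) : R :=
  N%:R^-1 * \sum_(n < N) \sum_(a | `[< A (iter n T (x a)) >]) nu a.

Hypothesis nu0 : forall a, 0 <= nu a.
Hypothesis nu1 : \sum_a nu a = 1.

Lemma orbit_mean_ge0 A : 0 <= orbit_mean A.
Proof. by rewrite mulr_ge0 ?invr_ge0 //; apply: sumr_ge0 => n _; exact: sumr_ge0. Qed.

Lemma orbit_meanT : (0 < N)%N -> orbit_mean setT = 1.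
Proof.
move=> N0; rewrite /orbit_mean (eq_bigr (fun=> 1)) => [|n _].
  by rewrite sumr_const card_ord mulVf // pnatr_eq0 -lt0n.
by rewrite -nu1; apply: eq_bigl => a; exact: asboolT.
Qed.

Lemma orbit_meanU A B : A `&` B = set0 ->
  orbit_mean (A `|` B) = orbit_mean A + orbit_mean B.
Proof.
move=> AB; rewrite /orbit_mean -mulrDr -big_split /=; congr (_ * _).
apply: eq_bigr => n _; rewrite [in RHS]big_mkcond [X in _ = _ + X]big_mkcond -big_split /=.
rewrite big_mkcond; apply: eq_bigr => a _; set y := iter n T (x a).
have : ~ (A `&` B) y by rewrite AB.
rewrite asbool_or; case: asboolP => Ay; case: asboolP => By //= nAB; rewrite ?addr0 ?add0r //.
by case: nAB.
Qed.

(** The two orbit sums differ by their end terms only. *)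
Lemma orbit_mean_shift A : `|orbit_mean (T @^-1` A) - orbit_mean A| <= 2 / N%:R.
Proof.
pose phi n := \sum_(a | `[< A (iter n T (x a)) >]) nu a.
have phi0 n : 0 <= phi n by exact: sumr_ge0.
have phi1 n : phi n <= 1.
  rewrite -nu1 [leLHS]big_mkcond; apply: ler_sum => a _; by case: ifP.
rewrite /orbit_mean -mulrBr -sumrB normrM ger0_norm ?invr_ge0 // mulrC.
rewrite ler_wpM2r ?invr_ge0 //.
have -> : \sum_(n < N) (\sum_(a | `[< (T @^-1` A) (iter n T (x a)) >]) nu a -
    \sum_(a | `[< A (iter n T (x a)) >]) nu a) = \sum_(0 <= n < N) (phi n.+1 - phi n).
  by rewrite big_mkord.
rewrite telescope_sumr // (le_trans (ler_normB _ _)) // !ger0_norm //.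
by have := phi1 N; have := phi1 0%N; lra.
Qed.

End orbit_mean.

Lemma sum_blocks {V : nmodType} (J m : nat) (F : nat -> V) :
  \sum_(n < J * m) F n = \sum_(j < J) \sum_(l < m) F (j * m + l)%N.
Proof.
elim: J => [|J IHJ]; first by rewrite !big_ord0.
by rewrite mulSnr big_split_ord /= IHJ big_ord_recr.
Qed.

Section block_coding.
Context {R : realType} {X : metricType R} (T : X -> X) (N m K L M : nat).
Variables (x : 'I_M -> X) (nu : 'I_M -> R).
Variables (kappa : X -> 'I_K) (c : 'I_K -> X) (dec : 'I_L -> 'I_m -> 'I_K).
Variables (W : 'I_K -> 'I_L -> R) (q : 'I_L -> R).
Variables (Lam r Del eta : R).
Hypothesis N0 : (0 < N)%N.
Hypothesis m0 : (0 < m)%N.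
Hypothesis nu0 : forall a, 0 <= nu a.
Hypothesis nu1 : \sum_a nu a = 1.
Hypothesis W0 : forall i b, 0 <= W i b.
Hypothesis W1 : forall i, \sum_b W i b = 1.
Hypothesis q0 : forall b, 0 <= q b.
Hypothesis q1 : \sum_b q b = 1.
Hypothesis Wq : forall i b, 0 < W i b -> 0 < q b.
Hypothesis Lam0 : 0 <= Lam.
Hypothesis r0 : 0 < r.
Hypothesis Delta : forall u v : X, mdist u v <= Del.
Hypothesis csmall : forall z l, (l < m)%N ->
  mdist (iter l T z) (iter l T (c (kappa z))) <= eta.
Hypothesis mass : forall y : 'I_N -> X,
  \sum_(a | \sum_(n < N) mdist (iter n T (x a)) (y n) <= r * N%:R) nu a <= 2 `^ (- (N%:R * Lam)).

Let J := (N %/ m - 1)%N.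
Let f i := \sum_b W i b * log2 (W i b / q b).
Let h i := \sum_b W i b * \sum_(l < m) mdist (iter l T (c i)) (c (dec b l)).

Let eta0 (z : X) : 0 <= eta.
Proof. by apply: le_trans (csmall z m0); exact: mdist_ge0. Qed.

Let Jm : (J * m <= N)%N.
Proof.
rewrite /J mulnBl mul1n; apply: leq_trans (leq_subr _ _) _; exact: leq_trunc_div.
Qed.

Let JmD : (N <= J * m + 2 * m)%N.
Proof.
have := divn_eq N m; have := ltn_pmod N m0; rewrite /J mulnBl; lia.
Qed.

(** J is one less than the number of full blocks in [0, N), so that for every offset
    k < m the J blocks starting at k fit into [0, N), at the price of at most 2 m
    uncovered times. *)
Lemma block_coding_offset (k : nat) : (k < m)%N ->
  N%:R * Lam - 1 <= \sum_a nu a * \sum_(j < J) f (kappa (iter (k + j * m) T (x a))) +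
    Lam / r * ((2 * m)%:R * Del + \sum_a nu a *
      \sum_(j < J) (h (kappa (iter (k + j * m) T (x a))) + m%:R * eta)).
Proof.
move=> km.
have kJN : (k + J * m <= N \/ J = 0)%N.
  have := leq_trunc_div N m; rewrite /J; case: (N %/ m)%N => [|t]; first by right.
  by rewrite mulnBl mul1n mulSn => tN; left; lia.
case: (pselect (exists x1 : 'I_M, True)) => [[a0 _]|noP]; last first.
  by move: nu1; rewrite big_pred0 => [|a]; [lra|exfalso; apply: noP; exists a].
pose Wk a (j : 'I_J) b := W (kappa (iter (k + j * m) T (x a))) b.
(* the uncovered times receive arbitrary letters *)
pose word (g : {ffun 'I_J -> 'I_L}) (n : nat) : X :=
  if insub ((n - k) %/ m)%N is Some j then
    c (dec (g j) (Ordinal (ltn_pmod (n - k) m0)))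
  else x a0.
have wordE g (j : 'I_J) (l : 'I_m) : word g (k + (j * m + l))%N = c (dec (g j) l).
  have jE : ((k + (j * m + l) - k) %/ m = j)%N.
    by rewrite addKn divnMDl // divn_small // addn0.
  rewrite /word jE valK; congr (c (dec _ _)); apply: val_inj => /=.
  by rewrite addKn modnMDl modn_small.
pose D a g := \sum_(n < N) mdist (iter n T (x a)) (word g n).
pose e a (j : 'I_J) b := m%:R * eta +
  \sum_(l < m) mdist (iter l T (c (kappa (iter (k + j * m) T (x a))))) (c (dec b l)).
have D0 a g : 0 <= D a g by apply: sumr_ge0 => n _; exact: mdist_ge0.
have Del0 : 0 <= Del by apply: le_trans (Delta (x a0) (x a0)); exact: mdist_ge0.
have De a g : D a g <= (2 * m)%:R * Del + \sum_j e a j (g j).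
  have blocks : \sum_(n < J * m) mdist (iter (k + n) T (x a)) (word g (k + n)) <=
      \sum_j e a j (g j).
    rewrite (sum_blocks J m (fun n => mdist (iter (k + n) T (x a)) (word g (k + n)))).
    apply: ler_sum => j _; rewrite /e -[m in m%:R](card_ord m) -sum1_card natr_sum.
    rewrite mulr_suml -big_split /=; apply: ler_sum => l _; rewrite wordE mul1r.
    rewrite addnA addnC iterD; set z := iter (k + j * m) T (x a).
    apply: le_trans (metric_triangle _ (iter l T (c (kappa z))) _) _.
    by rewrite lerD2r csmall.
  have sumDel u v : \sum_(u <= n < v) mdist (iter n T (x a)) (word g n) <= (v - u)%:R * Del.
    rewrite (@le_trans _ _ (\sum_(u <= n < v) Del)) //; first by apply: ler_sum.
    by rewrite sumr_const_nat mulr_natl.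
  rewrite /D -(big_mkord xpredT (fun n => mdist (iter n T (x a)) (word g n))).
  have [kJ|J0] := kJN; last first.
    apply: le_trans (sumDel 0%N N) _; apply: (@le_trans _ _ ((2 * m)%:R * Del)).
      by rewrite ler_wpM2r // ler_nat subn0; have := JmD; rewrite J0; lia.
    rewrite lerDl; apply: sumr_ge0 => j _; rewrite /e addr_ge0 ?mulr_ge0 ?(eta0 (x a)) //.
    by apply: sumr_ge0 => l _; exact: mdist_ge0.
  rewrite (@big_cat_nat _ _ _ k) //=; last by apply: leq_trans kJ; exact: leq_addr.
  rewrite (@big_cat_nat _ _ _ (k + J * m) k) //=; last exact: leq_addr.
  rewrite [X in _ + (X + _)](_ : _ =
    \sum_(n < J * m) mdist (iter (k + n) T (x a)) (word g (k + n))); last first.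
    rewrite -{1}[k]add0n big_addn addKn big_mkord.
    by apply: eq_bigr => n _; rewrite addnC.
  rewrite addrCA [leRHS]addrC lerD //.
  apply: le_trans (lerD (sumDel _ _) (sumDel _ _)) _.
  rewrite -mulrDl -natrD ler_wpM2r // ler_nat; have := JmD; lia.
have p01 : 0 < 2 `^ (- (N%:R * Lam)) <= 1.
  rewrite powR_gt0 //= -[leRHS](powRr0 2) ler_powR ?ler1n // oppr_le0.
  by rewrite mulr_ge0.
have rN0 : 0 < r * N%:R by rewrite mulr_gt0 // ltr0n.
have massD g : \sum_(a | D a g <= r * N%:R) nu a <= 2 `^ (- (N%:R * Lam)).
  exact: (mass (fun n => word g n)).
have := product_coding_bound (W := Wk) nu0 nu1 (fun a j b => W0 _ b)
  (fun a j => W1 _) q0 q1 (fun a j b => @Wq _ b) D0 De p01 rN0 massD.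
rewrite -powRN opprK log2_powR // log2_2 mulr1.
have -> : \sum_a nu a * (\sum_j \sum_b Wk a j b * e a j b) = \sum_a nu a *
    \sum_(j < J) (h (kappa (iter (k + j * m) T (x a))) + m%:R * eta).
  apply: eq_bigr => a _; congr (_ * _); apply: eq_bigr => j _.
  under eq_bigr do rewrite mulrDr.
  by rewrite big_split /= -mulr_suml W1 mul1r addrC.
set A := \sum_a nu a * \sum_(j < J) (_ + _); 
have NR : N%:R != 0 :> R by rewrite pnatr_eq0 -lt0n.
have -> : N%:R * Lam * (1 - (r * N%:R)^-1 * ((2 * m)%:R * Del + A)) =
   N%:R * Lam - Lam / r * ((2 * m)%:R * Del + A).
  by rewrite invfM; field; rewrite NR gt_eqF.
move=> main; rewrite -lerBlDr.
apply: (@le_trans _ _ (-1 + (N%:R * Lam - Lam / r * ((2 * m)%:R * Del + A)))).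
  by lra.
exact: main.
Qed.

(** Summing over all offsets k < m, the starting times k + j m run exactly once
    through [0, J m), which turns the sums over blocks into orbit sums. *)
Lemma block_coding :
  (forall i, 0 <= f i + Lam / r * (h i + m%:R * eta)) ->
  m%:R * Lam - (m%:R + (2 * m ^ 2)%:R * (Lam / r * Del)) / N%:R <=
  \sum_i (f i + Lam / r * (h i + m%:R * eta)) *
     orbit_mean T N x nu [set z | kappa z = i].
Proof.
set phi := fun i => f i + Lam / r * (h i + m%:R * eta) => phi0.
have NR : 0 < N%:R :> R by rewrite ltr0n.
have total : \sum_i phi i * orbit_mean T N x nu [set z | kappa z = i] =
    N%:R^-1 * \sum_(n < N) \sum_a nu a * phi (kappa (iter n T (x a))).
  rewrite /orbit_mean; under eq_bigr do rewrite mulrCA mulr_sumr.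
  rewrite -mulr_sumr exchange_big /=; congr (_ * _); apply: eq_bigr => n _.
  under eq_bigr do rewrite mulr_sumr big_mkcond.
  rewrite exchange_big /=; apply: eq_bigr => a _.
  rewrite (bigD1 (kappa (iter n T (x a)))) //= asboolT // big1 ?addr0 1?mulrC //.
  by move=> i ik; case: asboolP => //= ki; rewrite ki eqxx in ik.
have offset k : (k < m)%N -> N%:R * Lam - 1 - Lam / r * ((2 * m)%:R * Del) <=
    \sum_a nu a * \sum_(j < J) phi (kappa (iter (k + j * m) T (x a))).
  move=> /block_coding_offset; rewrite mulrDr => off.
  have -> : \sum_a nu a * \sum_(j < J) phi (kappa (iter (k + j * m) T (x a))) =
     \sum_a nu a * (\sum_(j < J) f (kappa (iter (k + j * m) T (x a)))) +
     Lam / r * \sum_a nu a *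
       \sum_(j < J) (h (kappa (iter (k + j * m) T (x a))) + m%:R * eta).
    rewrite mulr_sumr -big_split; apply: eq_bigr => a _ /=.
    rewrite [X in _ = _ + X]mulrCA -mulrDr; congr (_ * _).
    by rewrite mulr_sumr -big_split.
  by lra.
have all_offsets : m%:R * (N%:R * Lam - 1 - Lam / r * ((2 * m)%:R * Del)) <=
    \sum_(n < N) \sum_a nu a * phi (kappa (iter n T (x a))).
  apply: (@le_trans _ _ (\sum_(k < m) \sum_a nu a *
      \sum_(j < J) phi (kappa (iter (k + j * m) T (x a))))).
    rewrite -[m in m%:R](card_ord m) -sum1_card natr_sum mulr_suml.
    by apply: ler_sum => k _; rewrite mul1r; exact: offset.
  rewrite exchange_big [leRHS]exchange_big /=; apply: ler_sum => a _.
  rewrite -!mulr_sumr ler_wpM2l // exchange_big /=.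
  under eq_bigr do under eq_bigr do rewrite addnC.
  rewrite -(sum_blocks J m (fun n => phi (kappa (iter n T (x a))))).
  rewrite -(big_mkord xpredT (fun n => phi (kappa (iter n T (x a))))).
  rewrite -(big_mkord xpredT (fun n => phi (kappa (iter n T (x a))))).
  rewrite [leRHS](@big_cat_nat _ _ _ (J * m)) //= lerDl.
  by apply: sumr_ge0 => n _; exact: phi0.
rewrite total ler_pdivlMl //; apply: le_trans all_offsets.
rewrite le_eqVlt; apply/orP; left; apply/eqP.
by rewrite !natrM; field; rewrite !gt_eqF.
Qed.

End block_coding.

(** * Coverings and mean Hausdorff dimension *)

Section diameters.
Context {R : realType} {X : Type} (D : X -> X -> R).

Lemma diam_le (E : set X) (a : R) : 0 <= a ->
  (forall x y, E x -> E y -> D x y <= a) -> (diam D E <= a%:E)%E.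
Proof.
move=> a0 h; apply: ge_ereal_sup => _ [->|[x Ex [y Ey <-]]]; rewrite lee_fin //.
exact: h.
Qed.

Lemma diam_ge (E : set X) x y : E x -> E y -> ((D x y)%:E <= diam D E)%E.
Proof. by move=> Ex Ey; apply: ereal_sup_ubound; right; exists x => //; exists y. Qed.

Lemma diam_ge0 (E : set X) : (0 <= diam D E)%E.
Proof. by apply: ereal_sup_ubound; left. Qed.

Lemma diam_pow_ge0 (E : set X) s : (0 <= diam_pow D E s)%E.
Proof. by rewrite /diam_pow; case: ifP => // _; exact: poweR_ge0. Qed.

Lemma diam_pow_le (E : set X) (s a : R) : 0 <= s -> 0 <= a ->
  (diam D E <= a%:E)%E -> (diam_pow D E s <= (a `^ s)%:E)%E.
Proof.
move=> s0 a0 Ea; rewrite /diam_pow; case: ifP => _; first by rewrite lee_fin powR_ge0.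
rewrite -poweR_EFin; apply: gt0_ler_poweR => //.
  by rewrite in_itv /= diam_ge0 leey.
by rewrite in_itv /= lee_fin a0 leey.
Qed.

Lemma hausdorff_sum_le_cover (J : finType) (A : {set J}) (E : J -> set X)
    (a : J -> R) (s delta : R) : 0 <= s -> 0 < delta ->
  (forall j, 0 < a j < delta) ->
  (forall j y z, E j y -> E j z -> D y z <= a j) ->
  (forall y, exists2 j, j \in A & E j y) ->
  (hausdorff_sum D s delta <= (\sum_(j in A) a j `^ s)%:E)%E.
Proof.
move=> s0 d0 ad Ea cov.
pose L := map E (enum A); pose F n := nth set0 L n.
have diam0 : diam D set0 = 0%E.
  apply/eqP; rewrite eq_le diam_ge0 andbT; exact: diam_le.
have dE j : (diam D (E j) <= (a j)%:E)%E.
  by apply: diam_le; [have /andP[/ltW] := ad j|exact: Ea].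
apply: (@le_trans _ _ (\sum_(0 <= n <oo) diam_pow D (F n) s)%E).
  apply: ereal_inf_lbound; exists F => //; split.
    apply/seteqP; split => // x _; have [j jA Ej] := cov x.
    exists (index j (enum A)) => //; rewrite /F (nth_map j) ?index_mem ?mem_enum //.
    by rewrite nth_index ?mem_enum.
  move=> n; have [nL|nL] := ltnP n (size L); last first.
    by rewrite /F nth_default // diam0 lte_fin.
  have /mapP[j _ ->] : F n \in [seq E j | j <- enum A] by apply: mem_nth.
  by apply: le_lt_trans (dE j) _; rewrite lte_fin; have /andP[] := ad j.
rewrite (nneseries_split 0 (size L)); last by move=> *; exact: diam_pow_ge0.
rewrite [X in (_ + X)%E]eseries0 ?adde0; last first.
  by move=> i; rewrite add0n => iL _; rewrite /F nth_default // /diam_pow eqxx.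
rewrite add0n /F -(big_nth set0 xpredT (fun E => diam_pow D E s)) big_map.
rewrite big_enum /= -sumEFin; apply: lee_sum => j _.
by apply: diam_pow_le => //; have /andP[/ltW] := ad j.
Qed.

Lemma cover_of_hausdorff_dim (sigma delta : R) : 0 < sigma -> 0 < delta <= 1 ->
  (sigma%:E < hausdorff_dim D delta)%E ->
  forall (J : finType) (A : {set J}) (E : J -> set X) (a : J -> R),
     (forall j, 0 < a j < delta) ->
     (forall j y z, E j y -> E j z -> D y z <= a j) ->
     (forall y, exists2 j, j \in A & E j y) ->
     1 <= \sum_(j in A) a j `^ sigma.
Proof.
move=> s0 /andP[d0 d1] /ereal_sup_gt [_ [->|[s [s_ge0 Hs] <-]]].
  by rewrite lte_fin ltNge ltW.
rewrite lte_fin => ss J A E a ad Ea cov; rewrite -lee_fin.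
apply: (le_trans Hs); apply: le_trans (hausdorff_sum_le_cover s_ge0 d0 ad Ea cov) _.
rewrite lee_fin; apply: ler_sum => j _; apply: ger_powR; last exact: ltW.
by have /andP[-> /ltW /le_trans ->] := ad j.
Qed.

Lemma hausdorff_dim_anti (e e' : R) : e <= e' ->
  (hausdorff_dim D e' <= hausdorff_dim D e)%E.
Proof.
move=> ee'; apply: ereal_sup_le => v [->|[s [s0 Hs] <-]]; first by left.
right; exists s => //; split => //; apply: (le_trans Hs).
apply: ereal_inf_le_tmp => _ [E [Ecov Ed] <-]; exists E => //; split => // n.
by apply: lt_le_trans (Ed n) _; rewrite lee_fin.
Qed.

End diameters.

(** The limsup is nonincreasing in eps, so the limit defining the mean Hausdorff
    dimension exists and is a supremum, one of whose terms already exceeds s. *)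
Lemma frequently_large_dim {R : realType} {X : Type} (T : X -> X) (d : X -> X -> R)
    (s : R) : 0 < s -> (s%:E < mdimH T d)%E ->
  exists2 delta : R, 0 < delta <= 1 &
    forall n, exists2 N, (n < N)%N &
      ((N%:R * s)%:E < hausdorff_dim (dyn_dist T d N) delta)%E.
Proof.
move=> s0; rewrite /mdimH.
set F := fun eps => limn_esup (fun N => (N%:R^-1%:E * hausdorff_dim (dyn_dist T d N) eps)%E).
move=> sF.
have Fanti : {in `]0, 1[ &, nonincreasing_fun F}.
  move=> e e' _ _ ee'; rewrite /F !limn_esup_lim; apply: lee_lim.
  - exact: is_cvg_esups.
  - exact: is_cvg_esups.
  - apply: nearW => n; apply: ge_ereal_sup => _ [N nN <-].
    apply: (@le_trans _ _ (N%:R^-1%:E * hausdorff_dim (dyn_dist T d N) e)%E).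
      by rewrite lee_wpmul2l ?lee_fin ?invr_ge0 //; exact: hausdorff_dim_anti.
    by apply: ereal_sup_ubound; exists N.
have cvgN : (- F e)%E @[e --> 0^'+] --> ereal_inf ((fun e => (- F e)%E) @` `]0, 1[).
  apply: (nondecreasing_at_right_cvge (BLeft 1)); first by rewrite bnd_simp.
  by move=> e e' he he' ee'; rewrite leeN2; exact: Fanti.
have FE : lim (F e @[e --> 0^'+]) = (- ereal_inf ((fun e => (- F e)%E) @` `]0%R, 1%R[))%E.
  apply/cvg_lim => //; move/cvgeN : cvgN; rewrite /=; apply: cvg_trans.
  by apply: near_eq_cvg; apply: nearW => e; rewrite /= oppeK.
move: sF; rewrite FE lteNr => /ereal_inf_lt [_ [e ei <-]].
rewrite lteN2 => sFe; move: ei; rewrite /= in_itv /= => /andP[e0 e1].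
exists e; first by rewrite e0 ltW.
move=> n; have : (s%:E < ereal_sup ((fun N => (N%:R^-1%:E *
    hausdorff_dim (dyn_dist T d N) e)%E) @` [set N | (n < N)%N]))%E.
  apply: (lt_le_trans sFe); apply: ereal_inf_lbound => /=.
  by exists [set N | (n < N)%N] => //; exists n.+1.
move=> /ereal_sup_gt [_ [N /= nN <-]] h; exists N => //.
have N0 : 0 < N%:R :> R by rewrite ltr0n (leq_ltn_trans _ nN).
by rewrite EFinM -lte_pdivlMl.
Qed.

(** * Frostman measures for the dynamical metrics *)

Section dynamical_metric.
Context {R : realType} {X : metricType R} (T : X -> X) (N : nat).
Local Notation dN := (dyn_dist T (@mdist R X) N).

Lemma dyn_dist_leP (x y : X) (c : R) : 0 <= c ->
  dN x y <= c <-> forall n, (n < N)%N -> mdist (iter n T x) (iter n T y) <= c.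
Proof.
move=> c0; split=> [|h]; last by apply/bigmax_leP; split => // n _; exact: h.
by move=> /bigmax_leP [_ h] n nN; exact: (h (Ordinal nN)).
Qed.

Lemma dyn_dist_ge0 (x y : X) : 0 <= dN x y.
Proof. by rewrite /dyn_dist; apply: bigmax_ge_id. Qed.

Lemma dyn_distxx (x : X) : dN x x = 0.
Proof.
apply/eqP; rewrite eq_le dyn_dist_ge0 andbT; apply/dyn_dist_leP => // n _.
by rewrite mdistxx.
Qed.

Lemma dyn_dist_sym (x y : X) : dN x y = dN y x.
Proof. by apply: eq_bigr => n _; rewrite metric_sym. Qed.

Lemma dyn_dist_triangle (u x y : X) : dN x y <= dN x u + dN u y.
Proof.
apply/dyn_dist_leP => [|n nN]; first by rewrite addr_ge0 // dyn_dist_ge0.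
apply: le_trans (metric_triangle _ (iter n T u) _) _; apply: lerD.
  exact: (dyn_dist_leP x u (dyn_dist_ge0 x u)).1.
exact: (dyn_dist_leP u y (dyn_dist_ge0 u y)).1.
Qed.

End dynamical_metric.

Lemma powR2_log2 {R : realType} (x : R) : 0 < x -> 2 `^ log2 x = x.
Proof.
move=> x0; rewrite /powR pnatr_eq0 /= /log2 divfK ?lnK ?posrE //.
by rewrite gt_eqF // ln2_gt0.
Qed.

Section frostman_orbits.
Context {R : realType} {X : metricType R} (T : X -> X) (N k0 : nat) (s delta : R).
Local Notation dN := (dyn_dist T (@mdist R X) N).
Hypothesis X_compact : compact [set: X].
Hypothesis T_cont : continuous T.
Hypothesis N0 : (0 < N)%N.
Hypothesis s0 : 0 < s.
Hypothesis d01 : 0 < delta <= 1.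
Hypothesis k0d : 8 * 2^-1 ^+ k0 < delta.
Hypothesis dim : ((N%:R * s)%:E < hausdorff_dim dN delta)%E.

Let scale (k : nat) : R := 2^-1 ^+ (k0 + k).

Let scale_gt0 k : 0 < scale k. Proof. by rewrite exprn_gt0 // invr_gt0. Qed.

Let scale_anti k l : (k <= l)%N -> scale l <= scale k.
Proof.
move=> kl; rewrite /scale ler_wiXn2l ?invr_ge0 ?leq_add2l //.
by rewrite invf_le1 // ler1n.
Qed.

Lemma frostman_dyn_dist : exists (M : nat) (x : 'I_M -> X) (nu : 'I_M -> R),
  [/\ forall b, 0 <= nu b, \sum_b nu b = 1 &
    forall b k, (k <= N)%N ->
      \sum_(b' | dN (x b) (x b') <= scale k) nu b' <= (8 * scale k) `^ (N%:R * s)].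
Proof.
have [s_empty|/existsNP[x0 _]] := pselect (forall x : X, False).
  have sN0 : 0 < N%:R * s by rewrite mulr_gt0 // ltr0n.
  have := cover_of_hausdorff_dim sN0 d01 dim (J := 'I_0) (A := finset.set0)
    (E := fun=> set0) (a := fun=> 0).
  rewrite big_set0 ler10 => h; exfalso; suff : false by [].
  by apply: h => [[]//|[]//|y]; case: (s_empty y).
have near_orbit x : exists r, 0 < r /\ forall y, mdist x y < r ->
    forall l, (l < N)%N -> mdist (iter l T x) (iter l T y) < scale N.
  by have [r r0 rP] := small_iterates N x T_cont (scale_gt0 N); exists r.
have [r rP] := choice near_orbit.
have [c ccov] : exists c : seq X, forall y, exists2 x, x \in c & mdist x y < r x.
  apply: (@compact_finite_subcover X x0 X (fun x => [set y | mdist x y < r x])) => //.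
    by move=> x; exact: open_mdist_ball.
  by move=> x; exists x; rewrite /= mdistxx; have [] := rP x.
exists (size c); pose x (b : 'I_(size c)) := nth x0 c b.
have net y : exists b, dN y (x b) <= scale N.
  have [x1 x1c yx1] := ccov y; have i1 : (index x1 c < size c)%N by rewrite index_mem.
  exists (Ordinal i1); rewrite /x /= nth_index // dyn_dist_sym.
  by apply/dyn_dist_leP => [|n nN]; [exact: ltW|apply: ltW; exact: (rP x1).2].
have sN0 : 0 < N%:R * s by rewrite mulr_gt0 // ltr0n.
have scaleP (k : 'I_N.+1) : [/\ 0 < scale k, scale N <= scale k & 8 * scale k < delta].
  split=> //; first by rewrite scale_anti // -ltnS.
  apply: le_lt_trans k0d; rewrite ler_pM2l // -[k0 in leRHS]addn0.
  exact: scale_anti.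
have [nu [nu0 nu1 nuB]] := finite_frostman ord0 (dyn_distxx T N) (dyn_dist_sym T N)
  (dyn_dist_triangle T N) net scaleP (cover_of_hausdorff_dim sN0 d01 dim).
exists x, nu; split => // b k kN.
exact: (nuB b (Ordinal (kN : (k < N.+1)%N))).
Qed.

(** The sets of d_N-diameter at most 2 a are contained in balls of dyadic radius
    between 2 a and 4 a, hence the factor 32 = 8 * 4. The tame growth bound
    C^(a^theta) <= 2 makes the number of pieces of the mean ball at most 4^N. *)
Lemma frostman_mean_ball (M : nat) (x : 'I_M -> X) (nu : 'I_M -> R)
    (theta a : R) (C : nat) (V : 'I_C -> set X) :
  (forall b, 0 <= nu b) ->
  (forall b k, (k <= N)%N ->
    \sum_(b' | dN (x b) (x b') <= scale k) nu b' <= (8 * scale k) `^ (N%:R * s)) ->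
  0 < a -> 2 * a <= scale 0 -> scale N <= 4 * a ->
  (0 < C)%N -> (forall i u v, V i u -> V i v -> mdist u v <= a) ->
  (forall u, exists i, V i u) -> a `^ theta * log2 C%:R <= 1 ->
  forall y : 'I_N -> X,
    \sum_(b | \sum_(n < N) mdist (iter n T (x b)) (y n) <= a `^ theta * a * N%:R) nu b <=
    2 `^ (- (N%:R * (s * log2 a^-1 - 2 - 5 * s))).
Proof.
move=> nu0 nuB a0 a_le a_ge C0 Vdiam Vcov tame y.
have NR : 0 < N%:R :> R by rewrite ltr0n.
have CR : 0 < C%:R :> R by rewrite ltr0n.
have [k kN [k1 k2]] : exists2 k, (k <= N)%N & 2 * a <= scale k /\ scale k <= 4 * a.
  have ex : exists k, (k <= N)%N && (2 * a <= scale k) by exists 0%N.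
  have bd k : (k <= N)%N && (2 * a <= scale k) -> (k <= N)%N by case/andP.
  have [k /andP[kN k1] kmax] := ex_maxnP ex bd; exists k => //; split => //.
  have [kN'|kN'] := eqVneq k N; first by rewrite kN'.
  have kltN : (k < N)%N by rewrite ltn_neqAle kN' kN.
  have [h|] := leP (2 * a) (scale k.+1).
    by have := kmax k.+1; rewrite kltN h ltnn => /(_ isT).
  have -> : scale k.+1 = 2^-1 * scale k by rewrite /scale addnS exprS.
  by lra.
have small (E : pred 'I_M) : (forall b b', E b -> E b' ->
     forall n : 'I_N, mdist (iter n T (x b)) (iter n T (x b')) <= 2 * a) ->
    \sum_(b | E b) nu b <= (32 * a) `^ (N%:R * s).
  move=> Esmall; have [[b0 Eb0]|none] := pselect (exists b, E b); last first.
    rewrite big_pred0 ?powR_ge0 // => b; apply/negP => Eb; apply: none.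
    by exists b.
  apply: (@le_trans _ _ (\sum_(b' | dN (x b0) (x b') <= scale k) nu b')).
    rewrite big_mkcond [leRHS]big_mkcond; apply: ler_sum => b _.
    case: ifPn => [Eb|_]; last by case: ifP.
    rewrite ifT //; apply/dyn_dist_leP => [|n nN]; first exact: ltW.
    by apply: le_trans k1; exact: (Esmall _ _ Eb0 Eb (Ordinal nN)).
  apply: le_trans (nuB _ _ kN) _; apply: ge0_ler_powR.
  - by rewrite mulr_ge0 // ltW.
  - by rewrite nnegrE mulr_ge0 // ltW.
  - by rewrite nnegrE mulr_ge0 // ltW.
  - by lra.
rewrite (mulrAC (a `^ theta)).
apply: le_trans (@mean_ball_mass R X (@mdist R X) N C 'I_M nu (fun b n => iter n T (x b)) y V a
  (a `^ theta * N%:R) ((32 * a) `^ (N%:R * s)) mdist_ge0 (@metric_sym _ _)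
  (fun u v t => metric_triangle u t v) a0 C0 Vdiam Vcov small) _.
rewrite -powR_mulrn // -[C%:R](powR2_log2 CR) -powRrM.
have a32 : 0 < 32 * a by rewrite mulr_gt0.
rewrite -[32 * a](powR2_log2 a32) -powRrM -!powRD ?pnatr_eq0 ?implybT //.
rewrite ler_powR ?ler1n // log2M // log2V //.
have -> : log2 32 = 5 :> R.
  have -> : 32 = 2 `^ 5 :> R by rewrite (@powR_mulrn _ 2 5) // -natrX.
  by rewrite log2_powR // log2_2 mulr1.
have : N%:R * (a `^ theta * log2 C%:R) <= N%:R * 1 by rewrite ler_pM2l.
by nra.
Qed.

End frostman_orbits.

(** * The lower bound on the rate distortion function *)

Lemma expr_half_lt {R : realType} (e : R) : 0 < e ->
  exists k, forall n, (k <= n)%N -> 2^-1 ^+ n < e.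
Proof.
move=> e0; have [k ke] := ltr_add_invr (y := 0) e0; rewrite add0r in ke.
exists k => n kn; apply: le_lt_trans ke; rewrite exprVn lef_pV2 ?posrE ?exprn_gt0 //.
rewrite -natrX ler_nat; apply: leq_trans (ltn_expl n (ltnSn 1)).
by rewrite ltnS.
Qed.

Section compact_metric.
Context {R : realType} {X : metricType R}.
Hypothesis X_compact : compact [set: X].

Lemma mdist_bounded (x0 : X) : exists B : R, forall u v : X, mdist u v <= B.
Proof.
have [s cov] : exists s : seq nat, forall x, exists2 n, n \in s & mdist x0 x < n%:R.
  apply: (@compact_finite_subcover X x0 _ (fun n => [set x | mdist x0 x < n%:R])) => //.
    by move=> n; exact: open_mdist_ball.
  by move=> x; exists (Num.truncn (mdist x0 x)).+1; exact: truncnS_gt.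
pose b : R := (\max_(n <- s) n)%:R.
have le_b x : mdist x0 x <= b.
  have [n ns xn] := cov x; apply: (le_trans (ltW xn)); rewrite ler_nat.
  exact: (@leq_bigmax_seq _ s xpredT id).
exists (b + b) => u v; apply: le_trans (metric_triangle _ x0 _) _.
by rewrite metric_sym lerD.
Qed.

Lemma covering_numberP (x0 : X) (a : R) : 0 < a ->
  let C := covering_number (@mdist R X) a in
  (0 < C)%N /\ exists V : 'I_C -> set X,
    (forall i u v, V i u -> V i v -> mdist u v <= a) /\ (forall u, exists i, V i u).
Proof.
move=> a0 C.
have a3 : 0 < a / 3 by rewrite divr_gt0.
have [s cov] : exists s : seq X, forall x, exists2 c, c \in s & mdist c x < a / 3.
  apply: (@compact_finite_subcover X x0 _ (fun c => [set x | mdist c x < a / 3])) => //.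
    by move=> c; exact: open_mdist_ball.
  by move=> x; exists x; rewrite /= mdistxx.
have ex : exists n, `[< (1 <= n)%N /\ has_open_cover (@mdist R X) a n >].
  exists (size s); apply/asboolP; split.
    by have [c] := cov x0; case: (s).
  exists (fun i => [set x | mdist (nth x0 s i) x < a / 3]); split.
  - by move=> i; exact: open_mdist_ball.
  - apply/seteqP; split => // x _; have [c cs cx] := cov x.
    have ci : (index c s < size s)%N by rewrite index_mem.
    by exists (Ordinal ci) => //=; rewrite nth_index.
  - move=> i; apply: (@le_lt_trans _ _ ((a / 3 + a / 3)%:E)); last by rewrite lte_fin; lra.
    apply: diam_le => [|x y /= xi yi]; first by rewrite addr_ge0 ?ltW.
    apply: le_trans (metric_triangle _ (nth x0 s i) _) _.
    by rewrite metric_sym lerD // ltW.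
have [n /asboolP [n1 ncov] nmin] := ex_minnP ex.
have [C1 [V [_ Vcov Vdiam]] _] : [/\ (1 <= C)%N, has_open_cover (@mdist R X) a C &
    forall m : nat, (1 <= m)%N -> has_open_cover (@mdist R X) a m -> (C <= m)%N].
  apply: (@getPex _ [set n : nat | [/\ (1 <= n)%N, has_open_cover (@mdist R X) a n &
    forall m : nat, (1 <= m)%N -> has_open_cover (@mdist R X) a m -> (n <= m)%N]]).
  by exists n; split => // m m1 mcov; apply: nmin; apply/asboolP.
split=> //; exists V; split.
- move=> i u v Vu Vv; rewrite -lee_fin; apply: le_trans (ltW (Vdiam i)).
  exact: diam_ge.
- by move=> u; have : [set: X] u by []; rewrite -Vcov => -[i _ Vu]; exists i.
Qed.

Lemma tame_growth_small (theta : R) : tame_growth (@mdist R X) -> 0 < theta ->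
  exists2 a1 : R, 0 < a1 & forall a, 0 < a -> a < a1 ->
    a `^ theta * log2 (covering_number (@mdist R X) a)%:R <= 1.
Proof.
move=> tame theta0; have /cvgrPdist_lt /(_ 1 ltr01) := tame theta theta0.
move=> [a1 /= a10 near1]; exists a1 => // a a0 aa1.
have := near1 a; rewrite /= sub0r normrN gtr0_norm // sub0r normrN => /(_ aa1 a0).
by move=> /ltW; apply: le_trans; exact: ler_norm.
Qed.

End compact_metric.

Section lower_bound.
Context {R : realType} {X : metricType R} (T : X -> X).
Variables (s theta : R).
Hypothesis X_compact : compact [set: X].
Hypothesis T_homeo : homeomorphism T.
Hypothesis s0 : 0 < s.
Hypothesis theta0 : 0 < theta.
Hypothesis tame : tame_growth (@mdist R X).

Let Lam (a : R) : R := s * log2 a^-1 - 2 - 5 * s.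

(** The order of the choices matters: mu is fixed before a, eps and the coupling,
    which is possible because the Frostman bound for nu_N holds down to scales that tend to 0
    as N grows, so that every fixed a is admissible for large N. *)
Lemma rate_distortion_lower_bound : (s%:E < mdimH T (@mdist R X))%E ->
  exists (x0 : X) (mu : probability (borel x0) R),
    invariant_measure T mu /\
    exists2 a0 : R, 0 < a0 & forall a, 0 < a -> a < a0 -> forall eps,
      ((Lam a * (1 - eps / (a `^ theta * a)))%:E <=
        rate_distortion T (@mdist R X) mu eps)%E.
Proof.
move=> dim; have T_cont : continuous T by case: T_homeo.
have [delta d01 freq] := frequently_large_dim s0 dim.
have [k0 k0d] : exists k0, 8 * 2^-1 ^+ k0 < delta.
  have d8 : 0 < delta / 8 by have /andP[? _] := d01; rewrite divr_gt0.
  have [k0 h] := expr_half_lt d8; exists k0.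
  by rewrite -ltr_pdivlMl // mulrC; exact: h.
pose G : set nat := [set N | (0 < N)%N /\
  ((N%:R * s)%:E < hausdorff_dim (dyn_dist T (@mdist R X) N) delta)%E].
have Ginf n : exists2 N, (n <= N)%N & G N.
  have [N nN hN] := freq n; exists N; first exact: ltnW.
  by split => //; apply: leq_ltn_trans nN.
pose scale k : R := 2^-1 ^+ (k0 + k).
pose good N M (x : 'I_M -> X) (nu : 'I_M -> R) :=
  [/\ forall b, 0 <= nu b, \sum_b nu b = 1 &
    forall b k, (k <= N)%N ->
      \sum_(b' | dyn_dist T (@mdist R X) N (x b) (x b') <= scale k) nu b' <=
      (8 * scale k) `^ (N%:R * s)].
have frost N : G N -> exists M x nu, @good N M x nu.
  by move=> [N0 hN]; exact: (frostman_dyn_dist X_compact T_cont N0 s0 d01 k0d hN).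
have [x0 _] : exists x0 : X, True.
  have [N _ /frost [[|M] [x [nu [_ nu1 _]]]]] := Ginf 0%N.
    by move: nu1; rewrite big_ord0 => /eqP; rewrite eq_sym oner_eq0.
  by exists (x ord0).
have data_ex N : exists D : {M : nat & ('I_M -> X) * ('I_M -> R)}%type,
    G N -> good N _ (projT2 D).1 (projT2 D).2.
  have [/frost [M [x [nu g]]]|nG] := pselect (G N); first by exists (existT _ M (x, nu)).
  by exists (existT _ 0%N (fun=> x0, fun=> 0)).
have [data dataP] := choice data_ex.
pose mun N A := orbit_mean T N (projT2 (data N)).1 (projT2 (data N)).2 A.
have [p [p0 p1 pU pT plim]] : exists p : set X -> R, [/\ forall A, 0 <= p A, p setT = 1,
    forall A B, A `&` B = set0 -> p (A `|` B) = p A + p B,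
    forall A, p (T @^-1` A) = p A &
    forall (k : nat) (A : 'I_k -> set X) (f : 'I_k -> R) (l : R),
      (forall e, 0 < e -> exists N0, forall N, (N0 <= N)%N -> G N ->
         l - e <= \sum_i f i * mun N (A i)) ->
      l <= \sum_i f i * p (A i)].
  apply: ultra_mean_limit => //.
  - by move=> N A /dataP [nu0 _ _]; exact: orbit_mean_ge0.
  - by move=> N GN; have [nu0 nu1 _] := dataP N GN; case: GN => N0 _; exact: orbit_meanT.
  - by move=> N A B /dataP [nu0 nu1 _]; exact: orbit_meanU.
  - by move=> N A /dataP [nu0 nu1 _]; exact: orbit_mean_shift.
have [mu [mu_open mu_closed mu_inv]] := borel_extension x0 X_compact p0 pU p1.
exists x0, mu; split; first exact: mu_inv.
have [Del Delta] := mdist_bounded X_compact x0.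
have [a1 a10 tame1] := tame_growth_small tame theta0.
(* the second bound on a makes Lam a nonnegative *)
pose a2 := Num.min (2^-1 * scale 0%N) (2 `^ (- ((2 + 5 * s) / s))).
have a20 : 0 < a2 by rewrite lt_min mulr_gt0 ?invr_gt0 ?exprn_gt0 ?powR_gt0 // invr_gt0.
exists (Num.min a1 a2); first by rewrite lt_min a10.
move=> a a0; rewrite !lt_min => /and3P[aa1 aa2 aa3] eps.
have Lam0 : 0 <= Lam a.
  have := ler_log2 a0 (ltW aa3); rewrite log2_powR // log2_2 mulr1 => la.
  have : (2 + 5 * s) / s * s <= - log2 a * s by rewrite ler_pM2r // lerNr.
  by rewrite divfK ?gt_eqF // /Lam log2V //; lra.
have r0 : 0 < a `^ theta * a by rewrite mulr_gt0 ?powR_gt0.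
set r := a `^ theta * a in r0 *.
have [C0 [V [Vdiam Vcov]]] := covering_numberP X_compact x0 a0.
have [N1 N1a] : exists N1, forall N, (N1 <= N)%N -> scale N <= 4 * a.
  have [N1 h] := expr_half_lt (mulr_gt0 (ltr0n _ 4) a0).
  by exists N1 => N NN1; apply: ltW; apply: h; apply: leq_trans (leq_addl _ _).
apply: le_ereal_inf_tmp => _ [m [disp [Om [P [Z [Y [m0 lawZ cost ->]]]]]]].
(* the strict inequality in the distortion constraint leaves room for eta *)
have [eta eta0 cost'] : exists2 eta : R, 0 < eta &
   ('E_P[fun w => m%:R^-1 * \sum_(n < m) mdist (iter n T (Z w)) (tnth (Y w) n)]%R <=
     (eps - 3 * eta)%:E)%E.
  case: ('E_P[_])%E cost => [e | | _] //.
    rewrite lte_fin => ee; exists ((eps - e) / 3); first by rewrite divr_gt0 ?subr_gt0.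
    by rewrite lee_fin; lra.
  by exists 1 => //; exact: leNye.
have [k [F [pF Fnull Fsmall]]] := null_frontier_partition mu m X_compact T_cont eta0.
have F_ex i : exists x : X, F i x by case: pF => -[_ _ /(_ i Logic.I)].
have [c Fc] := choice F_ex.
have [l [dec [W [q [[W0 W1 q0 q1 Wq] info distort]]]]] :=
  discretize_coupling m0 lawZ pF Fc Fsmall cost'.
have muF i : fine (mu (F i)) = p (F i).
  rewrite (null_frontier_eq (p := p) _ mu_open mu_closed _ (Fnull i)) //.
    by move=> A B; exact: fadd_le.
  by case: pF.
pose f i := \sum_b W i b * log2 (W i b / q b).
pose h i := \sum_b W i b * \sum_(n < m) mdist (iter n T (c i)) (c (dec b n)).
have f0 i : 0 <= f i.
  by apply: (gibbs (W0 i) q0 (Wq i)); rewrite q1 W1.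
have h0 i : 0 <= h i.
  apply: sumr_ge0 => b _; rewrite mulr_ge0 // sumr_ge0 // => n _; exact: mdist_ge0.
have phi0 i : 0 <= f i + Lam a / r * (h i + m%:R * eta).
  rewrite addr_ge0 // mulr_ge0 ?divr_ge0 ?(ltW r0) // addr_ge0 // mulr_ge0 //.
  exact: ltW.
have key : m%:R * Lam a <=
    \sum_i (f i + Lam a / r * (h i + m%:R * eta)) * p (F i).
  apply: plim => e e0.
  pose B := m%:R + (2 * m ^ 2)%:R * (Lam a / r * Del).
  exists (maxn N1 (Num.truncn (B / e)).+1) => N; rewrite geq_max => /andP[NN1 NB] GN.
  have [nu0 nu1 nuB] := dataP N GN; have [N0 _] := GN.
  have NR : 0 < N%:R :> R by rewrite ltr0n.
  have a_le : 2 * a <= scale 0%N by lra.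
  have mass := frostman_mean_ball N0 s0 nu0 nuB a0 a_le (N1a _ NN1) C0 Vdiam Vcov
    (tame1 _ a0 aa1).
  have csmall (z : X) (j : nat) : (j < m)%N ->
      mdist (iter j T z) (iter j T (c (cell F (z : borel x0)))) <= eta.
    by move=> jm; apply: ltW; apply: Fsmall (Fc _) _ jm; exact/(cellP _ _ pF).
  have := block_coding N0 m0 nu0 nu1 W0 W1 q0 q1 Wq Lam0 r0 Delta csmall mass phi0.
  have -> : \sum_i (f i + Lam a / r * (h i + m%:R * eta)) *
        orbit_mean T N (projT2 (data N)).1 (projT2 (data N)).2
          [set z | cell F (z : borel x0) = i] =
      \sum_i (f i + Lam a / r * (h i + m%:R * eta)) * mun N (F i).
    apply: eq_bigr => i _.
    have Ei : [set z : X | cell F (z : borel x0) = i] = F i by exact: cell_preimage i pF.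
    by rewrite Ei.
  apply: le_trans; rewrite lerD2l lerN2 -/B ler_pdivrMr // mulrC -ler_pdivrMr //.
  by apply: ltW; apply: lt_le_trans (truncnS_gt _) _; rewrite ler_nat.
have sum_mu : \sum_i fine (mu (F i)) = 1.
  have mF i : measurable (cell F @^-1` [set i]).
    by rewrite (cell_preimage i pF); case: pF.
  transitivity (pr mu [set: borel x0]); last by rewrite /pr probability_setT.
  rewrite (pr_total mu measurableT mF); apply: eq_bigr => i _.
  by rewrite setTI (cell_preimage i pF).
have rate : m%:R * (Lam a * (1 - eps / r)) <= \sum_i fine (mu (F i)) * f i.
  have split_phi : \sum_i (f i + Lam a / r * (h i + m%:R * eta)) * p (F i) =
      \sum_i fine (mu (F i)) * f i +
      Lam a / r * (\sum_i fine (mu (F i)) * h i + m%:R * eta).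
    have sum_eta : m%:R * eta = \sum_i fine (mu (F i)) * (m%:R * eta).
      by rewrite -mulr_suml sum_mu mul1r.
    rewrite [in RHS]sum_eta -big_split mulr_sumr -big_split /=.
    by apply: eq_bigr => i _; rewrite muF; ring.
  have : Lam a / r * (\sum_i fine (mu (F i)) * h i + m%:R * eta) <=
      Lam a / r * (m%:R * eps).
    by rewrite ler_wpM2l // divr_ge0 // ltW.
  have -> : m%:R * (Lam a * (1 - eps / r)) = m%:R * Lam a - Lam a / r * (m%:R * eps).
    by field; rewrite gt_eqF.
  by move: key; rewrite split_phi; lra.
have mR : 0 < m%:R :> R by rewrite ltr0n.
rewrite -(lee_pmul2l (x := m%:R%:E)) ?lte_fin //.
rewrite [leRHS]muleA -[in leRHS]EFinM divff ?gt_eqF // mul1e -EFinM.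
by apply: le_trans info; rewrite lee_fin.
Qed.

End lower_bound.

(** * The variational inequality *)

(** With theta = s / u - 1 the choice a = (L eps)^(u / s) makes a^(1 + theta) equal to
    L eps, and s log (1 / a) equal to u log (1 / (L eps)). *)
Lemma lower_rdim_ge {R : realType} {X : topologicalType} {x0 : X} (T : X -> X)
    (d : X -> X -> R) (mu : probability (borel x0) R) (s u t2 t1 a0 : R) :
  0 < t1 -> t1 < t2 -> t2 < u -> u < s -> 0 < a0 ->
  (forall a, 0 < a -> a < a0 -> forall eps,
    (((s * log2 a^-1 - 2 - 5 * s) * (1 - eps / (a `^ (s / u - 1) * a)))%:E <=
      rate_distortion T d mu eps)%E) ->
  (t1%:E <= lower_rdim T d mu)%E.
Proof.
move=> t10 t12 t2u us a00 rate.
have t20 : 0 < t2 by apply: lt_trans t12.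
have u0 : 0 < u by apply: lt_trans t2u.
have s0 : 0 < s by apply: lt_trans us.
(* L is chosen so that 1 - 1 / L = t2 / u; the remaining margin t2 - t1 absorbs
   the constant C once log (1 / eps) is at least l0 *)
pose L := u / (u - t2).
have L0 : 0 < L by rewrite divr_gt0 ?subr_gt0.
pose C := u * log2 L + 2 + 5 * s.
pose l0 := t2 / u * C / (t2 - t1).
pose e1 := Num.min (2 `^ (- Num.max 1 l0)) (a0 `^ (s / u) / L).
have e10 : 0 < e1 by rewrite lt_min powR_gt0 //= divr_gt0 // powR_gt0.
rewrite /lower_rdim limf_einfE; apply: le_ereal_sup_tmp.
exists (ereal_inf ((fun eps => (rate_distortion T d mu eps * (log2 eps^-1)^-1%:E)%E) @`
   `]0, e1[)).
  exists `]0, e1[%classic => //; apply: filterS2 (nbhs_right_gt 0) (nbhs_right_lt e10).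
  by move=> e /= e_gt0 ee1; rewrite in_itv /= e_gt0.
apply: le_ereal_inf_tmp => _ [eps /= + <-].
rewrite in_itv /= lt_min => /and3P[eps0 epsl epsa].
pose l := log2 eps^-1.
have l_ge : Num.max 1 l0 <= l.
  have := ler_log2 eps0 (ltW epsl); rewrite log2_powR // log2_2 mulr1.
  by rewrite /l log2V // lerNr.
have [l1 ll0] : 1 <= l /\ l0 <= l by move: l_ge; rewrite ge_max => /andP.
have l_gt0 : 0 < l by apply: lt_le_trans l1.
have Leps0 : 0 < L * eps by rewrite mulr_gt0.
pose a := (L * eps) `^ (u / s).
have a_gt0 : 0 < a by rewrite powR_gt0.
have aa0 : a < a0.
  have -> : a0 = (a0 `^ (s / u)) `^ (u / s).
    rewrite -powRrM; have -> : s / u * (u / s) = 1 by field; rewrite !gt_eqF.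
    by rewrite powRr1 // ltW.
  apply: gt0_ltr_powR; rewrite ?nnegrE ?divr_gt0 ?powR_ge0 ?(ltW Leps0) //.
  by rewrite mulrC -ltr_pdivlMr.
have raE : a `^ (s / u - 1) * a = L * eps.
  rewrite -{2}[a]powRr1 ?(ltW a_gt0) // -powRD; last by rewrite (gt_eqF a_gt0) implybT.
  rewrite subrK.
  rewrite -powRrM; have -> : u / s * (s / u) = 1 by field; rewrite !gt_eqF.
  by rewrite powRr1 // ltW.
have loga : s * log2 a^-1 - 2 - 5 * s = u * l - C.
  rewrite log2V // log2_powR // log2M // /l log2V // /C.
  by field; rewrite gt_eqF.
have := rate a a_gt0 aa0 eps; rewrite raE loga.
have -> : 1 - eps / (L * eps) = t2 / u.
  by rewrite /L; field; rewrite !gt_eqF ?subr_gt0.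
move=> rate_eps.
have rate1 : ((t1 * l)%:E <= rate_distortion T d mu eps)%E.
  apply: le_trans rate_eps; rewrite lee_fin.
  have : l0 * (t2 - t1) <= l * (t2 - t1) by rewrite ler_pM2r // subr_gt0.
  have -> : l0 * (t2 - t1) = t2 / u * C by rewrite /l0 divfK // subr_eq0 gt_eqF.
  have -> : (u * l - C) * (t2 / u) = t2 * l - t2 / u * C by field; rewrite gt_eqF.
  lra.
rewrite -/l; apply: (@le_trans _ _ ((t1 * l)%:E * (l^-1)%:E)%E).
  by rewrite -EFinM mulfK // gt_eqF.
by rewrite lee_wpmul2r // lee_fin invr_ge0 ltW.
Qed.

(* The point x0 ranges over X so that an empty X, which carries no probability
   measure, is covered as well; the other data do not depend on it. *)
Theorem theorem3p11 (R : realType) (X : metricType R) (T : X -> X)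
    (X_compact : compact [set: X]) (T_homeo : homeomorphism T)
    (d_tame : tame_growth (@mdist R X)) :
  (mdimH T (@mdist R X) <=
   esup0 [set v : \bar R |
     exists (x0 : X) (mu : probability (borel x0) R),
       invariant_measure T mu /\ v = lower_rdim T (@mdist R X) mu])%E.
Proof.
rewrite leNgt; apply/negP => lt_dim.
set S := esup0 _ in lt_dim.
have S0 : (0 <= S)%E by apply: ereal_sup_ubound; left.
have [t St] : exists t : R, S = t%:E.
  case: S S0 lt_dim => [t _ _ | _ |]; first by exists t.
    by rewrite ltNge leey.
  by rewrite leNgt ltNyr.
rewrite St lee_fin in S0; rewrite St in lt_dim.
have [s [ts sdim]] : exists s : R, t < s /\ (s%:E < mdimH T (@mdist R X))%E.
  case: (mdimH T _) lt_dim => [D | _ |]; last by rewrite ltNge leNye.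
    rewrite lte_fin => tD; exists ((t + D) / 2); rewrite lte_fin.
    by split; lra.
  by exists (t + 1); rewrite ltry; split => //; lra.
pose gap := (s - t) / 4.
have gap0 : 0 < gap by rewrite divr_gt0 ?subr_gt0.
have s0 : 0 < s by apply: le_lt_trans ts.
have theta0 : 0 < s / (s - gap) - 1.
  by rewrite subr_gt0 ltr_pdivlMr ?mul1r; rewrite /gap; lra.
have [x0 [mu [mu_inv [a0 a00 rate]]]] :=
  rate_distortion_lower_bound X_compact T_homeo s0 theta0 d_tame sdim.
have : ((t + gap)%:E <= lower_rdim T (@mdist R X) mu)%E.
  by apply: (@lower_rdim_ge R X x0 T (@mdist R X) mu s (s - gap) (s - 2 * gap)
    (t + gap) a0) => //; rewrite /gap; lra.
apply/negP; rewrite -ltNge; apply: (@le_lt_trans _ _ S).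
  by apply: ereal_sup_ubound; right; exists x0, mu.
by rewrite St lte_fin ltrDl.
Qed.
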